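(* Let $k$ be any field. Let $G = C_{2n}(a,n)$ with $1 \leq a < n$, that is, $G$ is a cubic circulant graph, and let $t = \gcd(a,2n)$. Then $G$ is Cohen-Macaulay (over $k$) if and only if $\frac{2n}{t} = 3$ or $\frac{2n}{t} = 4$.
   Context: Here $n$ and $a$ are integers. Circulant graphs: given an integer $m \geq 1$ and $S \subseteq \{1,2,\ldots,\lfloor m/2 \rfloor\}$, the circulant graph $C_m(S)$ is the finite simple graph on vertices $\{x_1,\ldots,x_m\}$ such that $\{x_i,x_j\}$ (with $i \ne j$) is an edge if and only if $\min\{|i-j|,\, m-|i-j|\} \in S$. Set brackets are suppressed, so $C_{2n}(a,n) = C_{2n}(\{a,n\})$. A cubic graph is a graph in which every vertex has degree $3$. Cohen-Macaulay graphs: for a finite simple graph $G$ on $\{x_1,\ldots,x_m\}$, let $R = k[x_1,\ldots,x_m]$ and let $I(G) = \langle x_ix_j : \{x_i,x_j\} \text{ is an edge of } G\rangle$ be the edge ideal. $G$ is Cohen-Macaulay if $R/I(G)$ is a Cohen-Macaulay ring, i.e. its Krull dimension equals its depth, where depth is the length of the longest regular sequence on $R/I(G)$ in $\langle x_1,\ldots,x_m\rangle$. *)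

(* Defs.v *)
From HB Require Import structures.
From mathcomp Require Import all_boot all_order all_algebra.
From mathcomp Require Import generic_quotient ring_quotient boolp mpoly.
Set Implicit Arguments.
Unset Strict Implicit.
Unset Printing Implicit Defensive.

Import GRing.Theory.
Local Open Scope ring_scope.
Local Open Scope quotient_scope.

Definition is_max (P : nat -> Prop) (d : nat) : Prop :=
  P d /\ forall e, P e -> (e <= d)%N.

Definition generated_ideal (A : comNzRingType) (S : A -> Prop) : {pred A} :=
  fun x => `[< exists s : seq (A * A),
    (forall p, p \in s -> S p.2) /\ x = \sum_(p <- s) p.1 * p.2 >].

(* The condition [idealr_closed] of ring_quotient includes properness. *)
Definition prime_ideal (A : comNzRingType) (P : {pred A}) : Prop :=
  idealr_closed P /\ prime_idealr_closed P.

(* P 0, ..., P d is a strictly increasing chain of prime ideals, of length d;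
   the values of P beyond d are irrelevant. *)
Definition prime_chain (A : comNzRingType) (d : nat) (P : nat -> {pred A}) :
    Prop :=
  (forall i, (i <= d)%N -> prime_ideal (P i)) /\
  (forall i, (i < d)%N ->
     {subset P i <= P i.+1} /\ ~ {subset P i.+1 <= P i}).

Definition krull_dim (A : comNzRingType) : nat -> Prop :=
  is_max (fun d => exists P, @prime_chain A d P).

Definition regular_sequence (A : comNzRingType) (fs : seq A) : Prop :=
  1 \notin generated_ideal (fun f => f \in fs) /\
  forall i, (i < size fs)%N ->
    let J := generated_ideal (fun f => f \in take i fs) in
    forall g, fs`_i * g \in J -> g \in J.

Section PolynomialQuotient.
Variables (k : fieldType) (m : nat).
Local Notation R := {mpoly k[m]}.

Definition irrelevant_ideal : {pred R} :=
  generated_ideal (fun f => exists i : 'I_m, f = 'X_i).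

Definition depth (I : idealr R) : nat -> Prop :=
  is_max (fun d => exists fs : seq R,
    [/\ size fs = d, {subset fs <= irrelevant_ideal}
      & regular_sequence [seq \pi_({ideal_quot I}) f | f <- fs]]).

Definition cohen_macaulay_quotient (I : idealr R) : Prop :=
  exists d, krull_dim {ideal_quot I} d /\ depth I d.

End PolynomialQuotient.

Record simple_graph (m : nat) := SimpleGraph {
  edge :> rel 'I_m;
  edge_sym : ssrbool.symmetric edge;
  edge_irr : irreflexive edge
}.

Section EdgeIdeal.
Variables (k : fieldType) (m : nat) (G : simple_graph m).
Local Notation R := {mpoly k[m]}.

Definition edge_ideal : {pred R} :=
  generated_ideal (fun f => exists i j : 'I_m, G i j /\ f = 'X_i * 'X_j).

Lemma edge_ideal_closed : idealr_closed edge_ideal.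
Proof.
split.
- by apply/asboolP; exists [::]; split=> //; rewrite big_nil.
- apply/negP => /asboolP [s [sG s1]].
  have /eqP := congr1 (meval (fun=> 0)) s1.
  rewrite meval1 raddf_sum big_seq big1 ?oner_eq0 //= => p /sG [i [j [_ ->]]].
  by rewrite !mevalM !mevalXU mul0r mulr0.
- move=> a x y /asboolP [s [sG ->]] /asboolP [t [tG ->]]; apply/asboolP.
  exists ([seq (a * p.1, p.2) | p <- s] ++ t); split.
    by move=> p; rewrite mem_cat => /orP [/mapP [q /sG ? ->]|/tG].
  rewrite big_cat big_map mulr_sumr; congr (_ + _).
  by apply: eq_bigr => p _; rewrite mulrA.
Qed.

HB.instance Definition _ := isIdealr.Build R edge_ideal edge_ideal_closed.

Definition cohen_macaulay_graph : Prop := cohen_macaulay_quotient edge_ideal.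

End EdgeIdeal.

Section Circulant.
Variables (m : nat) (S : seq nat).

(* Vertices are numbered from 0.  For i != j the circular distance lies in
   {1, ..., m./2}, so elements of S outside that range play no role. *)
Definition circulant_rel : rel 'I_m := fun i j =>
  (i != j) && (minn `|i - j|%N (m - `|i - j|%N)%N \in S).

Lemma circulant_sym : ssrbool.symmetric circulant_rel.
Proof. by move=> i j; rewrite /circulant_rel distnC eq_sym. Qed.

Lemma circulant_irr : irreflexive circulant_rel.
Proof. by move=> i; rewrite /circulant_rel eqxx. Qed.

Definition circulant : simple_graph m :=
  SimpleGraph circulant_sym circulant_irr.

End Circulant.

(* Main.v *)
(* The edge ideal of G is the Stanley-Reisner ideal of its independence complex,
   whose quotient has the size alpha of a largest independent set as Krull
   dimension.  Chains of primes and regular sequences are both instances of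
   sequences f_1, ..., f_d such that f_i is a nonzerodivisor modulo the i-th
   ideal of an increasing chain and lies in the next one; the power products of
   the f_i are then linearly independent, and counting monomials with
   independent support gives d <= alpha.  So G is Cohen-Macaulay iff there is a
   regular sequence of length alpha in the irrelevant ideal.

   Put s = 2n / gcd(a, 2n).  For s = 3, 4 the graph is a union of triangular
   prisms or of copies of K_4, and the sums of the variables over the cliques of
   a clique partition form a regular sequence, by vertex decomposition along
   0 -> R/(J : x) -> R/J -> R/(J + (x)) -> 0.

   Otherwise, a regular sequence of length d kills the Koszul cohomology of the
   squares of the variables below degree d, hence, in suitable multidegrees, the
   reduced cohomology of the links of faces F below degree d - #|F|.  For s = 6
   (copies of K_{3,3}) a component has a disconnected independence complex, for
   s = 5, 8 one homotopy equivalent to a circle, and for all other s trading the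
   centre of an isolated claw for its leaves gives maximal independent sets of different sizes. *)
Require Import Defs.
From mathcomp Require Import all_boot all_order all_algebra.
From mathcomp Require Import generic_quotient ring_quotient boolp mpoly.
From mathcomp Require Import zify ring.
Set Implicit Arguments.
Unset Strict Implicit.
Unset Printing Implicit Defensive.
Import GRing.Theory.
Local Open Scope ring_scope.
Local Open Scope quotient_scope.

(** * Ideals as predicates, regular sequences, radicals *)

Section Ideals.
Variable A : comNzRingType.
Implicit Types (J : A -> Prop) (f g h x y : A) (fs : seq A).

Definition is_ideal J := J 0 /\ forall a x y, J x -> J y -> J (a * x + y).

Section Closure.
Variables (J : A -> Prop) (idJ : is_ideal J).

Lemma ideal0 : J 0. Proof. by case: idJ. Qed.

Lemma idealD x y : J x -> J y -> J (x + y).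
Proof. by move=> Jx Jy; rewrite -[x]mul1r; apply: idJ.2. Qed.

Lemma idealMl a x : J x -> J (a * x).
Proof. by move=> Jx; rewrite -[a * x]addr0; apply: idJ.2 => //; apply: ideal0. Qed.

Lemma idealN x : J x -> J (- x).
Proof. by move=> Jx; rewrite -mulN1r; apply: idealMl. Qed.

Lemma idealB x y : J x -> J y -> J (x - y).
Proof. by move=> Jx Jy; apply: idealD => //; apply: idealN. Qed.

Lemma idealBr x y : J (x - y) -> J y -> J x.
Proof. by move=> Jxy Jy; rewrite -[x](subrK y); apply: idealD. Qed.

Lemma idealBl x y : J (x - y) -> J x -> J y.
Proof. by move=> Jxy Jx; rewrite -[y](subKr x); apply: idealB. Qed.

Lemma ideal_sum (I : Type) (r : seq I) (P : pred I) (F : I -> A) :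
  (forall i, P i -> J (F i)) -> J (\sum_(i <- r | P i) F i).
Proof. by move=> JF; elim/big_ind: _ => //; [apply: ideal0 | apply: idealD]. Qed.

End Closure.

Definition adjoin J f : A -> Prop := fun g => exists h, J (g - h * f).

Lemma adjoin_ideal J f : is_ideal J -> is_ideal (adjoin J f).
Proof.
move=> idJ; split=> [|a x y [h Jx] [h' Jy]].
  by exists 0; rewrite mul0r subrr; apply: ideal0.
exists (a * h + h'); have -> : a * x + y - (a * h + h') * f =
  a * (x - h * f) + (y - h' * f) by ring.
exact: idJ.2.
Qed.

Lemma adjoin_sub J f g : J g -> adjoin J f g.
Proof. by move=> Jg; exists 0; rewrite mul0r subr0. Qed.

Lemma adjoin_gen J f : is_ideal J -> adjoin J f f.
Proof. by move=> idJ; exists 1; rewrite mul1r subrr; apply: ideal0. Qed.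

Definition nonzerodivisor_mod J f := forall g, J (f * g) -> J g.

(** The base case records that the ideal reached after adjoining the whole sequence is proper. *)
Fixpoint regular J fs : Prop :=
  if fs is f :: fs' then nonzerodivisor_mod J f /\ regular (adjoin J f) fs'
  else ~ J 1.

(* The common generalisation of regular sequences and chains of primes. *)
Fixpoint weakly_regular J fs : Prop :=
  if fs is f :: fs' then nonzerodivisor_mod J f /\
    exists J', [/\ is_ideal J', forall g, J g -> J' g, J' f
      & weakly_regular J' fs']
  else ~ J 1.

Lemma regularW J fs : is_ideal J -> regular J fs -> weakly_regular J fs.
Proof.
elim: fs J => [|f fs IH] J idJ //= [nzd reg]; split=> //.
exists (adjoin J f); split; first exact: adjoin_ideal.
- by move=> g; apply: adjoin_sub.
- exact: adjoin_gen.
- by apply: IH => //; apply: adjoin_ideal.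
Qed.

(* Regularity on both ends of
   0 -> A/(J : x) -> A/J -> A/(J + (x)) -> 0 passes to the middle. *)
Lemma regular_extension J (Jcolon Jadd : A -> Prop) x fs :
  is_ideal J ->
  (forall u, Jcolon u <-> J (x * u)) -> (forall g, Jadd g <-> adjoin J x g) ->
  regular Jcolon fs -> regular Jadd fs -> regular J fs.
Proof.
elim: fs J Jcolon Jadd => [|f fs IH] J J1 J2 idJ E1 E2 /=.
  by move=> _ n1 J_1; apply/n1/E2/adjoin_sub.
move=> [nzd1 reg1] [nzd2 reg2]; split.
  (* Regularity modulo J + (x) gives g = h x modulo J; then f h lies in J : x, and regularity there
     puts h in J : x. *)
  move=> g Jfg; have /E2 [h Jgh] : J2 g by apply/nzd2/E2/adjoin_sub.
  apply: (idealBr idJ Jgh); rewrite mulrC; apply/E1/nzd1/E1.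
  have -> : x * (f * h) = f * g - f * (g - h * x) by ring.
  by apply: idealB => //; apply: idealMl.
(* Induction applies to J + (f) once (J + (f)) : x = (J : x) + (f) is known. For the harder
   inclusion, x u = c f modulo J forces c into J + (x). *)
apply: IH reg1 reg2; first exact: adjoin_ideal.
  move=> u; split=> [[c /E1 Jc]|[c Jc]].
    by exists (x * c); rewrite -mulrA -mulrBr.
  have /E2 [w Jw] : J2 c.
    apply/nzd2/E2; exists u.
    have -> : f * c - u * x = - (x * u - c * f) by ring.
    exact: idealN.
  exists w; apply/E1.
  have -> : x * (u - w * f) = (x * u - c * f) + f * (c - w * x) by ring.
  by apply: idealD => //; apply: idealMl.
move=> g; split=> [[c /E2 [h Jh]]|[h [c Jc]]].
  by exists h, c; move: Jh; congr J; ring.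
by exists c; apply/E2; exists h; move: Jc; congr J; ring.
Qed.

Definition radical J f := exists p, J (f ^+ p).

Lemma radicalD J f g : is_ideal J ->
  radical J f -> radical J g -> radical J (f + g).
Proof.
move=> idJ [p Jf] [q Jg]; exists (p + q)%N; rewrite exprDn.
apply: ideal_sum => // i _; rewrite -mulr_natl; apply: idealMl => //.
have [le_qi|lt_iq] := leqP q i.
  by rewrite -(subnK le_qi) exprD mulrA; apply: idealMl.
have -> : (p + q - i = (q - i) + p)%N by lia.
by rewrite exprD mulrAC; apply: idealMl.
Qed.

Lemma radicalMl J a f : is_ideal J -> radical J f -> radical J (a * f).
Proof. by move=> idJ [p Jf]; exists p; rewrite exprMn; apply: idealMl. Qed.

End Ideals.

(** * The Koszul complex of a sequence of elements *)
Section Koszul.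
Variables (A : comNzRingType) (I : finType) (y : I -> A) (r : I -> nat).
Hypothesis r_inj : injective r.
Implicit Types (S : {set I}) (w : {set I} -> A) (J : A -> Prop).

(** The sign of moving e_v to its place in the wedge product over [S], in the order given by [r]. *)
Definition koszul_sign (v : I) S : bool := odd #|[set u in S | (r u < r v)%N]|.

Lemma koszul_signU v u S : u \notin S ->
  koszul_sign v (u |: S) = koszul_sign v S (+) (r u < r v)%N.
Proof.
move=> uS; rewrite /koszul_sign; case: (boolP (r u < r v)%N) => ruv.
  have -> : [set x in u |: S | (r x < r v)%N] =
    u |: [set x in S | (r x < r v)%N].
    by apply/setP => x; rewrite !inE; case: eqP => // ->; rewrite ruv.
  by rewrite cardsU1 !inE (negPf uS) addbT.
rewrite addbF; congr odd.
apply: eq_card => x; rewrite !inE; case: eqP => // ->.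
by rewrite (negPf ruv) (negPf uS).
Qed.

Lemma koszul_signD v u S : u \in S ->
  koszul_sign v (S :\ u) = koszul_sign v S (+) (r u < r v)%N.
Proof.
move=> uS; rewrite -{2}(setD1K uS) koszul_signU ?addbK //.
by rewrite !inE eqxx.
Qed.

(** Reading [w] as the sum of the w S e_S in the exterior algebra, this is left multiplication by
    the sum of the y_v e_v. *)
Definition koszul_diff w S : A :=
  \sum_(v in S) (-1) ^+ koszul_sign v S * y v * w (S :\ v).

Lemma koszul_diff0 w : koszul_diff w set0 = 0.
Proof. by rewrite /koszul_diff big_set0. Qed.

Lemma rank_total u v : u != v -> (r u < r v)%N = ~~ (r v < r u)%N.
Proof.
by move=> uv; rewrite -leqNgt ltn_neqAle (inj_eq r_inj) uv.
Qed.

(** Removing two vertices in either order leaves the same set with opposite signs, so the double sum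
    runs over an antisymmetric function. *)
Lemma koszul_diffK w S : koszul_diff (koszul_diff w) S = 0.
Proof.
rewrite /koszul_diff.
under eq_bigr => v vS do rewrite mulr_sumr big_mkcond /=.
rewrite big_mkcond /=.
pose t v u := (-1) ^+ (koszul_sign v S) * y v *
  ((-1) ^+ koszul_sign u (S :\ v) * y u * w (S :\ v :\ u)).
pose F v u := if (v \in S) && (u \in S) && (u != v) then t v u else 0.
transitivity (\sum_v \sum_u F v u).
  apply: eq_bigr => v _; rewrite /F; case: ifP => vS /=; last first.
    by rewrite big1.
  by apply: eq_bigr => u _; rewrite !inE andbC.
have antiF v u : F u v = - F v u.
  rewrite /F [v == u]eq_sym [(u \in S) && _]andbC.
  case: ifP => [/andP [/andP [vS uS] uv]|]; last by rewrite oppr0.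
  have -> : t u v = (-1) ^+ koszul_sign u S * y u *
      ((-1) ^+ koszul_sign v (S :\ u) * y v * w (S :\ v :\ u)).
    by congr (_ * (_ * w _)); apply/setP => x; rewrite !inE andbCA.
  rewrite /t !koszul_signD // (rank_total uv).
  by case: (koszul_sign v S); case: (koszul_sign u S); case: (r v < r u)%N
     => /=; rewrite ?expr0 ?expr1; ring.
rewrite (eq_bigr (fun v => \sum_(u | (r u < r v)%N) F v u
    + \sum_(u | (r v < r u)%N) F v u)); last first.
  move=> v _; rewrite (bigID (fun u => (r u < r v)%N)) /=; congr (_ + _).
  rewrite [RHS]big_mkcond [LHS]big_mkcond; apply: eq_bigr => u _.
  have [->|uv] := eqVneq u v; first by rewrite /F eqxx andbF ltnn.
  by rewrite (rank_total uv) negbK.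
rewrite big_split /= [X in _ + X](exchange_big_dep predT) //= -big_split /=.
rewrite big1 // => v _; rewrite -big_split /= big1 // => u _.
by rewrite [F u v]antiF subrr.
Qed.

Section Homotopy.
Variable a : I -> A.

Definition koszul_homotopy w S : A :=
  \sum_(v in ~: S) (-1) ^+ koszul_sign v S * a v * w (v |: S).

(** Terms that add one vertex and remove another cancel in pairs. Hence every element of
    [sequence_ideal] acts as zero on cohomology. *)
Lemma koszul_homotopyP w S :
  koszul_diff (koszul_homotopy w) S + koszul_homotopy (koszul_diff w) S =
  (\sum_v a v * y v) * w S.
Proof.
rewrite /koszul_diff /koszul_homotopy.
under eq_bigr => v vS do
  rewrite setCD setUC (big_setU1 _ _) ?inE ?vS //= setD1K // mulrDr.
under [X in _ + X]eq_bigr => v vS do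
  (rewrite inE in vS; rewrite (big_setU1 _ vS) /= setU1K // mulrDr).
rewrite !big_split /=.
have -> : (\sum_v a v * y v) * w S =
    \sum_(v in S) a v * y v * w S + \sum_(v in ~: S) a v * y v * w S.
  rewrite mulr_suml (bigID (mem S)) /=; congr (_ + _).
  by apply: eq_bigl => v; rewrite !inE.
have E1 : \sum_(v in S) (-1) ^+ koszul_sign v S * y v *
    ((-1) ^+ koszul_sign v (S :\ v) * a v * w S)
  = \sum_(v in S) a v * y v * w S.
  apply: eq_bigr => v vS; rewrite koszul_signD // ltnn addbF.
  by case: koszul_sign; rewrite ?expr1 ?expr0; ring.
have E2 : \sum_(v in ~: S) (-1) ^+ koszul_sign v S * a v *
    ((-1) ^+ koszul_sign v (v |: S) * y v * w S)
  = \sum_(v in ~: S) a v * y v * w S.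
  apply: eq_bigr => v; rewrite inE => vS; rewrite koszul_signU // ltnn addbF.
  by case: koszul_sign; rewrite ?expr1 ?expr0; ring.
rewrite E1 E2 -!addrA; congr (_ + _); rewrite addrC -addrA.
rewrite -[RHS]addr0; congr (_ + _).
under eq_bigr => v vS do rewrite mulr_sumr.
under [X in _ + X]eq_bigr => v vS do rewrite mulr_sumr.
rewrite exchange_big /= -big_split /= big1 //.
move=> v vS; rewrite -big_split /= big1 // => u; rewrite inE => uS.
have uv : u != v by apply: contraNneq uS => ->.
rewrite koszul_signD // koszul_signU // (rank_total uv).
have -> : u |: (S :\ v) = (u |: S) :\ v.
  by apply/setP => x; rewrite !inE; case: eqP => // ->; rewrite uv.
by case: (koszul_sign v S); case: (koszul_sign u S); case: (r v < r u)%N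
  => /=; rewrite ?expr0 ?expr1; ring.
Qed.

End Homotopy.

Lemma koszul_diffZ f w S :
  koszul_diff (fun T => f * w T) S = f * koszul_diff w S.
Proof. by rewrite /koszul_diff mulr_sumr; apply: eq_bigr => v _; ring. Qed.

Lemma koszul_diffB w w' S :
  koszul_diff (fun T => w T - w' T) S = koszul_diff w S - koszul_diff w' S.
Proof. by rewrite /koszul_diff -sumrB; apply: eq_bigr => v _; ring. Qed.

Lemma koszul_diff_ideal J w S : is_ideal J ->
  (forall v, v \in S -> J (w (S :\ v))) -> J (koszul_diff w S).
Proof.
by move=> idJ Jw; apply: ideal_sum => // v vS; apply: idealMl => //; apply: Jw.
Qed.

(** Vanishing of the degree [i] cohomology of the Koszul complex over A/J. *)
Definition koszul_acyclic J i := forall w,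
  (forall S, #|S| = i.+1 -> J (koszul_diff w S)) ->
  exists z, forall S, #|S| = i -> J (w S - koszul_diff z S).

Definition sequence_ideal : A -> Prop := fun g => exists a, g = \sum_v a v * y v.

Lemma sequence_ideal_ideal : is_ideal sequence_ideal.
Proof.
split=> [|b x x' [a ->] [a' ->]].
  by exists (fun=> 0); rewrite big1 // => v _; rewrite mul0r.
exists (fun v => b * a v + a' v); rewrite mulr_sumr -big_split /=.
by apply: eq_bigr => v _; ring.
Qed.

(** Induction through the long exact sequence of 0 -> A/J -> A/J -> A/(J + (f)) -> 0: multiplication
    by f is injective on degree i because degree i - 1 vanishes modulo J + (f), while a power of f
    is null-homotopic. *)
Lemma regular_koszul_acyclic J fs i : is_ideal J -> regular J fs ->
  (forall f, f \in fs -> radical sequence_ideal f) -> (i < size fs)%N ->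
  koszul_acyclic J i.
Proof.
elim: fs J i => [|f fs IH] J i idJ //= [nzd reg] radf ltis w Jw.
have descend v : (forall S, #|S| = i.+1 -> J (koszul_diff v S)) ->
    (exists z, forall S, #|S| = i -> J (f * v S - koszul_diff z S)) ->
    exists z, forall S, #|S| = i -> J (v S - koszul_diff z S).
  move=> Jv [z Jz]; case: i ltis Jw Jv Jz => [|i] ltis _ Jv Jz.
    exists z => S S0; move: (Jz S S0); move/cards0_eq: S0 => ->.
    by rewrite koszul_diff0 !subr0; apply: nzd.
  (* The cochain z is a cocycle modulo f, hence z = dx + f c; as ddx = 0, this gives f v = f dc, and
     f cancels. *)
  have [x Jx] : exists x, forall S, #|S| = i ->
      adjoin J f (z S - koszul_diff x S).
    apply: IH => //; first exact: adjoin_ideal.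
      by move=> g gfs; apply: radf; rewrite inE gfs orbT.
    move=> S S1; exists (v S); rewrite -opprB [v S * f]mulrC.
    by apply: idealN => //; apply: Jz.
  have [c Jc] : exists c, forall S, #|S| = i ->
      J (z S - koszul_diff x S - c S * f).
    suff /choice [c Jc] : forall S, exists c, #|S| = i ->
        J (z S - koszul_diff x S - c * f) by exists c.
    move=> S; have [Si|Si] := pselect (#|S| = i); last by exists 0.
    by have [h Jh] := Jx S Si; exists h.
  exists c => S Si; apply: nzd.
  have : J (koszul_diff (fun T => z T - koszul_diff x T - f * c T) S).
    apply: koszul_diff_ideal => // u uS; rewrite [f * _]mulrC; apply: Jc.
    by apply/eqP; rewrite -eqSS -Si (cardsD1 u S) uS.
  rewrite (koszul_diffB (fun T => z T - koszul_diff x T)) koszul_diffB.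
  rewrite koszul_diffK koszul_diffZ subr0 => Jzc.
  rewrite mulrBr -[f * v S](subrK (koszul_diff z S)) -addrA.
  by apply: idealD => //; apply: Jz.
have [|p [a fp]] := radf f; first by rewrite inE eqxx.
have: exists z, forall S, #|S| = i -> J (f ^+ p * w S - koszul_diff z S).
  exists (koszul_homotopy a w) => S Si; rewrite fp -koszul_homotopyP addrC addKr.
  apply: ideal_sum => // v; rewrite inE => vS; apply: idealMl => //.
  by apply: Jw; rewrite cardsU1 vS Si.
elim: p {fp} => [|p IHp] [z Jz].
  by exists z => S /Jz; rewrite mul1r.
apply: IHp; apply: descend.
  by move=> S Si; rewrite koszul_diffZ; apply: idealMl => //; apply: Jw.
by exists z => S /Jz; rewrite exprS mulrA.
Qed.

End Koszul.

(** * Generated ideals and the two forms of regular sequences *)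

Section GeneratedIdeals.
Variable A : comNzRingType.
Implicit Types (J K : A -> Prop) (fs : seq A).

Definition adjoin_seq J fs : A -> Prop := foldl (@adjoin A) J fs.

Lemma adjoin_seq_ideal J fs : is_ideal J -> is_ideal (adjoin_seq J fs).
Proof. by elim: fs J => //= f fs IH J idJ; apply/IH/adjoin_ideal. Qed.

Lemma adjoin_seq_sub J fs g : J g -> adjoin_seq J fs g.
Proof. by elim: fs J => //= f fs IH J Jg; apply/IH/adjoin_sub. Qed.

Lemma adjoin_seq_gen J fs f : is_ideal J -> f \in fs -> adjoin_seq J fs f.
Proof.
elim: fs J => //= h fs IH J idJ; rewrite inE => /predU1P [->|ffs].
  exact/adjoin_seq_sub/adjoin_gen.
exact/IH/ffs/adjoin_ideal.
Qed.

Lemma adjoin_seq_min J K fs : is_ideal K -> (forall g, J g -> K g) ->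
  (forall f, f \in fs -> K f) -> forall g, adjoin_seq J fs g -> K g.
Proof.
move=> idK; elim: fs J => //= f fs IH J JK fsK; apply: IH.
  move=> g [h /JK Kgh]; apply: (idealBr idK Kgh); apply: idealMl => //.
  by apply: fsK; rewrite inE eqxx.
by move=> g gfs; apply: fsK; rewrite inE gfs orbT.
Qed.

Lemma generated_ideal_ideal (S : A -> Prop) :
  is_ideal (fun x => x \in generated_ideal S).
Proof.
split; first by apply/asboolP; exists [::]; split=> //; rewrite big_nil.
move=> a x y /asboolP [s [sS ->]] /asboolP [t [tS ->]]; apply/asboolP.
exists ([seq (a * p.1, p.2) | p <- s] ++ t); split.
  by move=> p; rewrite mem_cat => /orP [/mapP [q /sS ? ->]|/tS].
rewrite big_cat big_map mulr_sumr; congr (_ + _).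
by apply: eq_bigr => p _; rewrite mulrA.
Qed.

Lemma generated_ideal_gen (S : A -> Prop) f : S f -> f \in generated_ideal S.
Proof.
move=> Sf; apply/asboolP; exists [:: (1, f)]; split.
  by move=> p; rewrite inE => /eqP ->.
by rewrite big_seq1 mul1r.
Qed.

Lemma generated_ideal_min (S : A -> Prop) K : is_ideal K ->
  (forall f, S f -> K f) -> forall g, g \in generated_ideal S -> K g.
Proof.
move=> idK SK g /asboolP [s [sS ->]]; rewrite big_seq; apply: ideal_sum => // p.
by move=> /sS /SK; apply: idealMl.
Qed.

Lemma zero_ideal : is_ideal (fun x : A => x = 0).
Proof. by split=> // a x y -> ->; rewrite mulr0 addr0. Qed.

Lemma generated_ideal_seqE fs g :
  g \in generated_ideal (fun f => f \in fs) <-> adjoin_seq (fun x => x = 0) fs g.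
Proof.
have idfs := adjoin_seq_ideal fs zero_ideal.
split.
  apply: (generated_ideal_min idfs) => f.
  by apply/adjoin_seq_gen/zero_ideal.
have idG := generated_ideal_ideal (fun f => f \in fs).
apply: (adjoin_seq_min idG) => [x ->|]; first exact: (ideal0 idG).
by move=> f ffs; apply: generated_ideal_gen.
Qed.

Lemma regularP J fs : regular J fs <->
  ~ adjoin_seq J fs 1 /\ forall i, (i < size fs)%N ->
    nonzerodivisor_mod (adjoin_seq J (take i fs)) fs`_i.
Proof.
elim: fs J => [|f fs IH] J /=; first by split=> [?|[]].
split=> [[nzd /IH [n1 reg]]|[n1 reg]].
  by split=> // -[_|i /reg].
split; first exact: (reg 0%N isT).
by apply/IH; split=> // i /(reg i.+1).
Qed.

Lemma regular_sequenceP fs :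
  regular_sequence fs <-> regular (fun x => x = 0) fs.
Proof.
rewrite regularP; split=> [[n1 reg]|[n1 reg]]; split.
- by move/generated_ideal_seqE; apply/negP.
- by move=> i /reg nzd g /generated_ideal_seqE /nzd /generated_ideal_seqE.
- by apply/negP => /generated_ideal_seqE.
- by move=> i /reg nzd J g /generated_ideal_seqE /nzd /generated_ideal_seqE.
Qed.

End GeneratedIdeals.

(** * Lifting regular sequences from a quotient ring *)

Section QuotientIdeals.
Variables (R : comNzRingType) (I : idealr R).
Local Notation Q := {ideal_quot I}.

Lemma pi_ideal_eq0 (g : R) : (\pi_Q g = 0) <-> g \in I.
Proof.
rewrite -(rmorph0 (\pi_Q)) -[g in g \in I]subr0 Quotient.idealrBE.
by split=> /eqP.
Qed.

Lemma regular_pi (J : Q -> Prop) (fs : seq R) :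
  regular J [seq \pi_Q f | f <- fs] <-> regular (fun g => J (\pi_Q g)) fs.
Proof.
elim: fs J => [|f fs IH] J /=; first by rewrite rmorph1.
have -> : adjoin (fun g => J (\pi_Q g)) f = fun g => adjoin J (\pi_Q f) (\pi_Q g).
  apply/funext => g; apply/propext; split=> [[h Jh]|[h Jh]].
    by exists (\pi_Q h); rewrite -rmorphM -rmorphB.
  by exists (repr h); rewrite rmorphB rmorphM /= reprK.
split=> -[nzd reg]; split; try exact/IH.
  by move=> g; rewrite rmorphM; apply: nzd.
by move=> q; rewrite -[q]reprK -rmorphM; apply: nzd.
Qed.

Lemma regular_sequence_pi (fs : seq R) :
  regular_sequence [seq \pi_Q f | f <- fs] <-> regular (fun g => g \in I) fs.
Proof.
rewrite regular_sequenceP regular_pi.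
suff -> : (fun g => \pi_Q g = 0) = (fun g => g \in I : Prop) by [].
by apply/funext => g; apply/propext/pi_ideal_eq0.
Qed.

End QuotientIdeals.

(** * Stanley-Reisner ideals *)
Section StanleyReisner.
Variables (k : fieldType) (m : nat).
Local Notation R := {mpoly k[m]}.
Implicit Types (f g : R) (D : {set 'I_m} -> bool) (S T W : {set 'I_m}).

Definition mono_supp (u : 'X_{1..m}) : {set 'I_m} := [set i | u i != 0%N].

Definition simplicial D := forall S T, S \subset T -> D T -> D S.

(** The Stanley-Reisner ideal, described through coefficients rather than generators. *)
Definition sr_ideal D : R -> Prop := fun f => forall u, D (mono_supp u) -> f@_u = 0.

Lemma mono_suppD u v : mono_supp (u + v)%MM = mono_supp u :|: mono_supp v.
Proof. by apply/setP => i; rewrite !inE mnmDE addn_eq0 negb_and. Qed.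

Lemma mono_suppU i : mono_supp U_(i)%MM = [set i].
Proof.
by apply/setP => j; rewrite !inE mnm1E [j == i]eq_sym; case: (i == j).
Qed.

Lemma mono_supp0 : mono_supp 0%MM = set0.
Proof. by apply/setP => i; rewrite !inE mnm0E. Qed.

Lemma mcoeffMXE f (n u : 'X_{1..m}) :
  (f * 'X_[n])@_u = if (n <= u)%MM then f@_(u - n)%MM else 0.
Proof.
case: ifPn => [le_nu|nle]; first by rewrite -{1}(submK le_nu) addmC mcoeffMX.
apply: memN_msupp_eq0; apply: contra nle; rewrite (perm_mem (msuppMX _ _)).
by case/mapP => v _ ->; apply: lem_addr.
Qed.

Lemma sr_idealMl D a f : simplicial D -> sr_ideal D f -> sr_ideal D (a * f).
Proof.
move=> simD Df u Du; rewrite mcoeffM big1 // => -[v w] /= /eqP uE.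
rewrite [f@__]Df ?mulr0 //; apply: simD Du.
by rewrite (etrans (congr1 mono_supp uE) (mono_suppD _ _)) subsetUr.
Qed.

Lemma sr_ideal_ideal D : simplicial D -> is_ideal (sr_ideal D).
Proof.
move=> simD; split=> [u _|a f g Df Dg u Du]; first by rewrite mcoeff0.
by rewrite mcoeffD Dg // addr0; apply: (sr_idealMl _ simD Df).
Qed.

Lemma eq_sr_ideal D D' : D =1 D' -> sr_ideal D = sr_ideal D'.
Proof. by move=> /funext ->. Qed.

Definition sr_star (v : 'I_m) D S := D (v |: S).
Definition sr_deletion (v : 'I_m) D S := D S && (v \notin S).

Lemma simplicial_star v D : simplicial D -> simplicial (sr_star v D).
Proof. by move=> simD S T ST; apply/simD/setUS. Qed.

Lemma simplicial_deletion v D : simplicial D -> simplicial (sr_deletion v D).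
Proof.
move=> simD S T ST /andP [DT vT]; rewrite /sr_deletion (simD _ _ ST DT) /=.
by apply: contra vT; apply: subsetP.
Qed.

Lemma lem1P (v : 'I_m) (u : 'X_{1..m}) :
  (U_(v) <= u)%MM = (v \in mono_supp u).
Proof.
rewrite inE; apply/mnm_lepP/idP => [/(_ v)|uv i].
  by rewrite mnm1E eqxx -lt0n.
by rewrite mnm1E; case: eqP => // <-; rewrite lt0n.
Qed.

Lemma sr_ideal_star v D f : simplicial D ->
  sr_ideal (sr_star v D) f <-> sr_ideal D ('X_v * f).
Proof.
move=> simD; rewrite mulrC; split=> Df u Du.
  rewrite mcoeffMXE lem1P; case: ifP => // vu; apply: Df.
  rewrite -lem1P in vu; rewrite /sr_star -mono_suppU -mono_suppD addmC.
  by rewrite submK.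
have := Df (U_(v) + u)%MM; rewrite mcoeffMX; apply.
by rewrite mono_suppD mono_suppU.
Qed.

Lemma sr_ideal_deletion v D f :
  sr_ideal (sr_deletion v D) f <-> adjoin (sr_ideal D) 'X_v f.
Proof.
split=> [Df|[h Dh] u /andP [Du vu]]; last first.
  have := Dh u Du; rewrite mcoeffB mcoeffMXE lem1P (negPf vu) subr0.
  exact.
(* The cofactor collects the terms of [f] divisible by the variable of [v], each divided by it. *)
exists (\sum_(u <- msupp f | v \in mono_supp u) f@_u *: 'X_[u - U_(v)]) => u Du.
rewrite mulr_suml mcoeffB raddf_sum /=.
have E w : v \in mono_supp w ->
    (f@_w *: 'X_[w - U_(v)] * 'X_v)@_u = f@_w * (w == u)%:R.
  by move=> vw; rewrite -scalerAl -mpolyXD submK ?lem1P // mcoeffZ mcoeffX.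
rewrite (eq_bigr _ E); have [vu|vu] := boolP (v \in mono_supp u); last first.
  rewrite Df /sr_deletion ?Du // big1 ?subr0 // => w vw.
  by case: eqP => [wu|]; rewrite ?mulr0 //; rewrite wu (negPf vu) in vw.
have [uf|uf] := boolP (u \in msupp f); last first.
  rewrite (memN_msupp_eq0 uf) big_seq_cond big1 ?subr0 // => w /andP [wf _].
  by case: eqP => [wu|]; rewrite ?mulr0 //; rewrite -wu wf in uf.
rewrite big_mkcond (bigD1_seq u) ?msupp_uniq //= vu eqxx mulr1 big1.
  by rewrite addr0 subrr.
by move=> w /negPf ->; rewrite mulr0 if_same.
Qed.

Lemma sr_ideal_proper D : D set0 -> ~ sr_ideal D 1.
Proof.
move=> D0 /(_ 0%MM); rewrite mono_supp0 D0 mcoeff1 eqxx => /(_ isT) /eqP.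
by rewrite oner_eq0.
Qed.

Definition sr_simplex W S := S \subset W.

Lemma simplicial_simplex W : simplicial (sr_simplex W).
Proof. by move=> S T; apply: subset_trans. Qed.

(** The ring endomorphism killing the variables outside [W]. Its kernel is the ideal of the simplex,
    which is therefore prime. *)
Definition sr_restrict W f := f \mPo [tuple if v \in W then 'X_v else 0 | v < m].

Lemma mcoeff_restrict W f u :
  (sr_restrict W f)@_u = if mono_supp u \subset W then f@_u else 0.
Proof.
have XE w : 'X_[w] \mPo [tuple if v \in W then 'X_v else 0 | v < m] =
    if mono_supp w \subset W then 'X_[w] else 0 :> R.
  rewrite comp_mpolyX; case: ifPn => [/subsetP wW|].
    rewrite [RHS]mpolyXE_id; apply: eq_bigr => i _; rewrite tnth_mktuple.
    by case: ifPn => // iW; case: (w i =P 0%N) => [->//|/eqP wi];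
      case/negP: iW; apply: wW; rewrite inE.
  case/subsetPn => i; rewrite inE => wi iW.
  by rewrite (bigD1 i) //= tnth_mktuple (negPf iW) expr0n (negPf wi) mul0r.
rewrite /sr_restrict {1}[f]mpolyE [X in X@_u](raddf_sum (comp_mpoly _)) raddf_sum.
under eq_bigr => w _ do rewrite /= comp_mpolyZ XE mcoeffZ.
rewrite [f in RHS]mpolyE raddf_sum /=.
under [X in if _ then X else _]eq_bigr => w _ do rewrite mcoeffZ mcoeffX.
case: ifP => uW; [|rewrite big1 // => w _]; last first.
  case: ifP => wW; rewrite ?mcoeff0 ?mulr0 // mcoeffX.
  by case: eqP => [wu|]; rewrite ?mulr0 // -wu wW in uW *.
apply: eq_bigr => w _; case: ifP => wW; rewrite ?mcoeffX // mcoeff0.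
by case: eqP => // wu; rewrite wu uW in wW.
Qed.

Lemma sr_simplexE W f : sr_ideal (sr_simplex W) f <-> sr_restrict W f = 0.
Proof.
split=> [Wf|Wf u uW]; last first.
  by have := congr1 (mcoeff u) Wf; rewrite mcoeff_restrict mcoeff0 ifT.
apply/mpolyP => u; rewrite mcoeff_restrict mcoeff0.
by case: ifP => // /Wf.
Qed.

Lemma sr_simplex_prime W f g : sr_ideal (sr_simplex W) (f * g) ->
  sr_ideal (sr_simplex W) f \/ sr_ideal (sr_simplex W) g.
Proof.
rewrite !sr_simplexE /sr_restrict rmorphM /= => /eqP.
by rewrite mulf_eq0 => /orP [] /eqP; [left | right].
Qed.

(** * Colour sums as regular sequences *)

Section Balanced.
Variables (c : 'I_m -> nat).

Definition color_sum q : R := \sum_(v | c v == q) 'X_v.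

(* Vertex decomposability, with respect to a colouring whose colours [qs] all
   occur exactly once in every facet; [W] is the only facet of a leaf. *)
Inductive balanced_decomposable (qs : seq nat) :
    ({set 'I_m} -> bool) -> Prop :=
| BalancedSimplex D W : D =1 sr_simplex W ->
    (forall q, q \in qs -> #|[set v in W | c v == q]| = 1%N) ->
    balanced_decomposable qs D
| BalancedShed D v : balanced_decomposable qs (sr_star v D) ->
    balanced_decomposable qs (sr_deletion v D) ->
    balanced_decomposable qs D.

(** Modulo the ideal of the simplex, a colour sum is the variable of the one vertex of that colour
    in [W]; adjoining it deletes this vertex and leaves the other colours intact. *)
Lemma simplex_regular qs W : uniq qs ->
  (forall q, q \in qs -> #|[set v in W | c v == q]| = 1%N) ->
  regular (sr_ideal (sr_simplex W)) [seq color_sum q | q <- qs].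
Proof.
elim: qs W => [|q qs IH] W /=.
  by move=> _ _; apply: sr_ideal_proper; apply: sub0set.
case/andP => qqs uqs Wqs.
have /eqP/cards1P [u Wu] := Wqs q (mem_head _ _).
have /setIdP [uW /eqP cu] : u \in [set v in W | c v == q] by rewrite Wu set11.
have idW W' := sr_ideal_ideal (@simplicial_simplex W').
have qE : sr_ideal (sr_simplex W) (color_sum q - 'X_u).
  rewrite /color_sum (bigD1 u) ?cu //= addrAC subrr add0r.
  apply: ideal_sum => // v /andP [cv vu] w wW; rewrite mcoeffX.
  case: eqP => // vw; move: wW; rewrite -vw mono_suppU /sr_simplex sub1set => vW.
  have : v \in [set v in W | c v == q] by rewrite inE vW.
  by rewrite Wu inE (negPf vu).
split=> [g Wg|].
  have Wug : sr_ideal (sr_simplex W) ('X_u * g).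
    by apply: (idealBl (idW _) _ Wg); rewrite -mulrBl mulrC; apply: (idealMl (idW W)).
  move=> w wW; apply: ((sr_ideal_star u g (@simplicial_simplex W)).2 Wug).
  by rewrite /sr_star /sr_simplex subUset sub1set uW.
have -> : adjoin (sr_ideal (sr_simplex W)) (color_sum q) =
    sr_ideal (sr_simplex (W :\ u)).
  apply/funext => g; apply/propext.
  have -> : sr_simplex (W :\ u) = sr_deletion u (sr_simplex W).
    by apply/funext => S; rewrite /sr_simplex /sr_deletion subsetD1.
  rewrite sr_ideal_deletion; split=> -[h Wh]; exists h.
    have -> : g - h * 'X_u = (g - h * color_sum q) + h * (color_sum q - 'X_u).
      by ring.
    by apply: (idealD (idW W)) => //; apply: (idealMl (idW W)).
  have -> : g - h * color_sum q = (g - h * 'X_u) - h * (color_sum q - 'X_u).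
    by ring.
  by apply: (idealB (idW W)) => //; apply: (idealMl (idW W)).
apply: IH => // q' q'qs; rewrite -(Wqs q') ?inE ?q'qs ?orbT //.
apply: eq_card => v; rewrite !inE; case: eqP => // ->.
rewrite cu; case: eqP => [qq'|]; last by rewrite !andbF.
by rewrite qq' q'qs in qqs.
Qed.

(** Each shedding is an instance of [regular_extension], with x the variable of the shed vertex. *)
Lemma balanced_regular qs D : uniq qs -> simplicial D ->
  balanced_decomposable qs D ->
  regular (sr_ideal D) [seq color_sum q | q <- qs].
Proof.
move=> uqs simD decD; elim: decD simD => {}D => [W DW Wqs _|v _ IH1 _ IH2 simD].
  by rewrite (eq_sr_ideal DW); apply: simplex_regular.
have reg1 := IH1 (simplicial_star simD).
have reg2 := IH2 (simplicial_deletion simD).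
apply: regular_extension reg1 reg2; first exact: sr_ideal_ideal.
  by move=> f; apply: sr_ideal_star.
by move=> f; apply: sr_ideal_deletion.
Qed.

End Balanced.

End StanleyReisner.

(** * Regular sequences and the cohomology of links *)

Section Obstruction.
Variables (k : fieldType) (m : nat) (r : 'I_m -> nat).
Hypothesis r_inj : injective r.
Local Notation R := {mpoly k[m]}.
Implicit Types (D : {set 'I_m} -> bool) (S F : {set 'I_m}).

Lemma irrelevant_radical (f : R) : f \in @irrelevant_ideal k m ->
  radical (sequence_ideal (fun v => 'X_[U_(v) *+ 2])) f.
Proof.
have idy := sequence_ideal_ideal (fun v : 'I_m => 'X_[U_(v) *+ 2] : R).
apply: generated_ideal_min => [|g [v ->]].
  split=> [|a g h radg radh]; first by exists 1%N; rewrite expr1; apply: ideal0.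
  by apply: radicalD => //; apply: radicalMl.
exists 2%N, (fun u => (u == v)%:R); rewrite (bigD1 v) //= eqxx mul1r big1.
  by rewrite addr0 mpolyXn.
by move=> u /negPf ->; rewrite mul0r.
Qed.

(* The exponent of the degree in which the Koszul complex on the squares of
   the variables becomes the cochain complex of the link of [F]. *)
Let link_mono F S : 'X_{1..m} :=
  [multinom (if v \in F then 1 else if v \in S then 2 else 0)%N | v < m].

Lemma link_mono_supp F S : F \subset S -> mono_supp (link_mono F S) = S.
Proof.
move=> /subsetP FS; apply/setP => v; rewrite !inE mnmE.
by case: ifP => [/FS ->|_] //; case: ifP.
Qed.

Lemma link_monoD1 F S v : v \in S -> v \notin F ->
  (link_mono F (S :\ v) + U_(v) *+ 2)%MM = link_mono F S.
Proof.
move=> vS vF; apply/mnmP => u; rewrite mnmDE mulmnE mnm1E !mnmE !inE.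
rewrite [v == u]eq_sym; case: eqP => [->|_]; first by rewrite (negPf vF) vS.
by rewrite /= addn0.
Qed.

(** Placing phi S on the monomial [link_mono F S] turns a cochain of the link of [F] into a Koszul
    cochain on the squares of the variables; reading off the same coefficients goes back. The degree
    [i] counts the vertices of [F] as well. *)
Lemma sr_obstruction D F (fs : seq R) i (phi : {set 'I_m} -> k) :
  simplicial D -> regular (sr_ideal D) fs ->
  {subset fs <= @irrelevant_ideal k m} -> (i < size fs)%N ->
  (forall S, D S -> F \subset S -> #|S| = i.+1 ->
    \sum_(v in S :\: F) (-1) ^+ koszul_sign r v S * phi (S :\ v) = 0) ->
  exists psi, forall S, D S -> F \subset S -> #|S| = i ->
    phi S = \sum_(v in S :\: F) (-1) ^+ koszul_sign r v S * psi (S :\ v).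
Proof.
move=> simD reg fs_irr ltis cocycle.
pose y (v : 'I_m) : R := 'X_[U_(v) *+ 2].
pose w S : R := if F \subset S then phi S *: 'X_[link_mono F S] else 0.
have sumF S (G : 'I_m -> k) : (forall v, v \in F -> G v = 0) ->
    \sum_(v in S) G v = \sum_(v in S :\: F) G v.
  move=> GF; rewrite (bigID (mem F)) /= big1 ?add0r; last first.
    by move=> v /andP [_ /GF].
  by apply: eq_bigl => v; rewrite !inE andbC.
have signZ (b : bool) (g : R) u : ((-1) ^+ b * g)@_u = (-1) ^+ b * g@_u.
  by rewrite !mulr_sign; case: b; rewrite // mcoeffN.
have acyc : koszul_acyclic y r (sr_ideal D) i.
  apply: (regular_koszul_acyclic r_inj _ reg) => //; first exact: sr_ideal_ideal.
  by move=> f ffs; apply/irrelevant_radical/fs_irr.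
have [S Si u Du|z Dz] := acyc w.
  rewrite raddf_sum /=.
  pose G v := (-1) ^+ koszul_sign r v S * (y v * w (S :\ v))@_u.
  rewrite (eq_bigr G); last by move=> v _; rewrite -mulrA signZ.
  have wF v : v \in F -> w (S :\ v) = 0.
    by move=> vF; rewrite /w subsetD1 vF andbF.
  rewrite sumF; last by move=> v vF; rewrite /G wF // mulr0 mcoeff0 mulr0.
  have [FS|nFS] := boolP (F \subset S); last first.
    rewrite big1 // => v _; rewrite /G /w ifF ?mulr0 ?mcoeff0 ?mulr0 //.
    by apply: contraNF nFS => /subset_trans; apply; apply: subD1set.
  have GE v : v \in S :\: F -> G v =
      (-1) ^+ koszul_sign r v S * phi (S :\ v) * (link_mono F S == u)%:R.
    case/setDP => vS vF; rewrite /G /w subsetD1 FS vF -scalerAr.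
    by rewrite mcoeffZ -mpolyXD addmC link_monoD1 // mcoeffX mulrA.
  rewrite (eq_bigr _ GE) -mulr_suml.
  have [Fu|] := eqVneq; last by rewrite mulr0.
  by rewrite cocycle ?mul0r // -(link_mono_supp FS) Fu.
exists (fun T => (z T)@_(link_mono F T)) => S DS FS Si.
have := Dz S Si (link_mono F S); rewrite link_mono_supp // => /(_ DS).
rewrite mcoeffB /w FS mcoeffZ mcoeffX eqxx mulr1 => /eqP.
rewrite subr_eq0 => /eqP ->; rewrite raddf_sum /=.
pose G v := (-1) ^+ koszul_sign r v S * (z (S :\ v) * y v)@_(link_mono F S).
rewrite (eq_bigr G); last by move=> v _; rewrite -mulrA signZ [y v * _]mulrC.
rewrite sumF.
  apply: eq_bigr => v /setDP [vS vF]; congr (_ * _).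
  by rewrite mcoeffMXE -(link_monoD1 vS vF) lem_addl addmK.
(* The exponent at a vertex of [F] is 1, so the square of its variable does not divide the
   monomial. *)
move=> v vF; rewrite /G mcoeffMXE ifF ?mulr0 //; apply/negP => /mnm_lepP /(_ v).
by rewrite mulmnE mnm1E eqxx mnmE vF.
Qed.

End Obstruction.

(** * Krull dimension and depth of Stanley-Reisner rings *)
Section Dimension.
Variables (k : fieldType) (m : nat).
Local Notation R := {mpoly k[m]}.
Implicit Types (D : {set 'I_m} -> bool) (S W : {set 'I_m}) (J : R -> Prop).

(** Exponent vectors are built by recursion to match the recursion of [power_product] on the
    sequence. *)
Fixpoint exponents (N d : nat) : finType :=
  if d is d'.+1 then ('I_N * exponents N d')%type : finType else unit.

Lemma card_exponents N d : #|exponents N d| = (N ^ d)%N.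
Proof.
elim: d => [|d IH] /=; first by rewrite card_unit.
by rewrite card_prod IH card_ord expnS.
Qed.

Fixpoint power_product N (fs : seq R) : exponents N (size fs) -> R :=
  if fs is f :: fs' then fun e => f ^+ (e.1 : nat) * @power_product N fs' e.2
  else fun=> 1.

Lemma ideal_scale J (a : k) g : is_ideal J -> J g -> J (a *: g).
Proof. by move=> idJ Jg; rewrite -mul_mpolyC; apply: idealMl. Qed.

(* Dividing a relation by the largest possible power of the first element and
   reducing modulo that element leaves a relation between the others. *)
Lemma weakly_regular_free J fs N (c : exponents N (size fs) -> k) :
  is_ideal J -> weakly_regular J fs ->
  J (\sum_e c e *: power_product e) -> forall e, c e = 0.
Proof.
elim: fs J c => [|f fs IH] J c idJ /=.
  move=> n1; rewrite (big_pred1 tt) => [|[]] // Jc [].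
  have [//|c0] := eqVneq (c tt) 0; case: n1.
  have /(ideal_scale (c tt)^-1 idJ) := Jc.
  by rewrite scalerA mulVf // scale1r.
case=> nzd [J' [idJ' JJ' J'f reg']] Jc.
pose g j := \sum_e c (j, e) *: @power_product N fs e.
have {Jc} Jg : J (\sum_(j < N) f ^+ j * g j).
  suff -> : \sum_(j < N) f ^+ j * g j =
      \sum_e c e *: @power_product N (f :: fs) e.
    by [].
  transitivity (\sum_(j < N) \sum_e c (j, e) *: (f ^+ j * @power_product N fs e)).
    apply: eq_bigr => j _; rewrite mulr_sumr; apply: eq_bigr => e _.
    by rewrite scalerAr.
  by rewrite pair_bigA; apply: eq_bigr => -[].
(* Strong induction on the exponent of f: once the coefficients of smaller exponents vanish, f^n
   cancels, and modulo J' only [g j] survives because f lies in J'. *)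
suff c0 n : forall j : 'I_N, j = n :> nat -> forall e, c (j, e) = 0.
  by move=> [j e]; apply: (c0 j).
elim/ltn_ind: n => n IHn j jn e.
apply: (IH J' (fun e => c (j, e))) => //; rewrite -/(g j).
have nzdX p h : J (f ^+ p * h) -> J h.
  by elim: p => [|p IHp]; rewrite ?mul1r // exprS -mulrA => /nzd.
have : J (\sum_(i < N | (n <= i)%N) f ^+ (i - n) * g i).
  apply: (nzdX n); move: Jg; rewrite (bigID (fun i : 'I_N => (n <= i)%N)) /=.
  rewrite [X in _ + X]big1 ?addr0; last first.
    move=> i; rewrite -ltnNge => /IHn /(_ i erefl) ci.
    by rewrite /g big1 ?mulr0 // => e' _; rewrite ci scale0r.
  rewrite mulr_sumr; congr J; apply: eq_bigr => i ni.
  by rewrite mulrA -exprD subnKC.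
rewrite (bigD1 j) ?jn //= subnn mul1r => /JJ'; rewrite -[X in _ + X]opprK.
move/(idealBr idJ'); apply; apply: idealN => //; apply: ideal_sum => // i.
case/andP => ni ij; have ni' : (n < i)%N.
  by rewrite ltn_neqAle ni andbT -jn eq_sym.
have [p ->] : exists p, (i - n = p.+1)%N by exists (i - n).-1; lia.
have -> : f ^+ p.+1 * g i = (f ^+ p * g i) * f by rewrite exprS; ring.
exact: idealMl.
Qed.

End Dimension.

(** * Counting monomials with face support *)

Section Counting.
Variables (k : fieldType) (m : nat).
Local Notation R := {mpoly k[m]}.
Implicit Types (D : {set 'I_m} -> bool) (S W : {set 'I_m}) (J : R -> Prop).

Definition degree_le (p : R) b := forall u, u \in msupp p -> (mdeg u <= b)%N.

Lemma degree_leM p q b c :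
  degree_le p b -> degree_le q c -> degree_le (p * q) (b + c).
Proof.
move=> pb qc u /msuppM_le /allpairsP [[v w] /= [vp wq ->]].
by rewrite mdegD leq_add ?pb ?qc.
Qed.

Lemma degree_le1 b : degree_le 1 b.
Proof. by move=> u; rewrite msupp1 inE => /eqP ->; rewrite mdeg0. Qed.

Lemma degree_leX p b n : degree_le p b -> degree_le (p ^+ n) (n * b).
Proof.
move=> pb; elim: n => [|n IH]; first by rewrite expr0; apply: degree_le1.
by rewrite exprS mulSn; apply: degree_leM.
Qed.

Lemma power_product_degree N (fs : seq R) b (e : exponents N (size fs)) :
  (forall f, f \in fs -> degree_le f b) ->
  degree_le (power_product e) (size fs * (N * b)).
Proof.
elim: fs e => [|f fs IH] /= e fsb; first exact: degree_le1.
rewrite mulSn; apply: degree_leM.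
  move=> u /(degree_leX (fsb f (mem_head _ _))) /leq_trans; apply.
  by rewrite leq_mul2r ltnW ?orbT.
by apply: IH => g gfs; apply: fsb; rewrite inE gfs orbT.
Qed.

Definition face_monos D N : {set 'X_{1..m < N.+1}} :=
  [set u : 'X_{1..m < N.+1} | D (mono_supp u)].

(** There are at most 2^m supports, and on each at most a exponents vary, among N + 1 values. *)
Lemma card_face_monos D N a : (forall S, D S -> (#|S| <= a)%N) ->
  (#|face_monos D N| <= 2 ^ m * N.+1 ^ a)%N.
Proof.
move=> Da; rewrite -sum1_card.
rewrite (partition_big (fun u : 'X_{1..m < N.+1} => mono_supp u) D) /=; last first.
  by move=> u; rewrite inE.
have card_supp S : D S ->
    (\sum_(u in face_monos D N | mono_supp u == S) 1 <= N.+1 ^ a)%N.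
  move=> DS; rewrite sum1_card.
  pose val_fun (u : 'X_{1..m < N.+1}) : {ffun 'I_m -> 'I_N.+1} :=
    [ffun i => inord (u i)].
  have ltuN (u : 'X_{1..m < N.+1}) i : (u i < N.+1)%N.
    by apply: leq_ltn_trans (bmdeg u); rewrite mdegE (bigD1 i) //= leq_addr.
  have val_fun_inj : injective val_fun.
    move=> u v uv; apply/val_inj/mnmP => i.
    move/ffunP: uv => /(_ i) /(congr1 val).
    by rewrite !ffunE /= !inordK ?ltuN.
  rewrite -(card_image val_fun_inj).
  apply: (@leq_trans #|pffun_on (ord0 : 'I_N.+1) (mem S) predT|).
    apply/subset_leq_card/subsetP => g /imageP [u /andP [_ /eqP uS] ->].
    apply/pffun_onP; split=> //; apply/subsetP => i.
    rewrite !inE !ffunE; apply: contraLR; rewrite -uS inE !negbK => /eqP ->.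
    by apply/eqP/val_inj; rewrite /= inordK.
  by rewrite card_pffun_on card_ord leq_pexp2l //; apply: Da.
apply: (leq_trans (leq_sum _ card_supp)); rewrite sum_nat_const leq_mul2r.
apply/orP; right; apply: (leq_trans (max_card _)).
by rewrite -cardsT -powersetT card_powerset cardsT card_ord.
Qed.

Lemma wide_kernel (n p : nat) (M : 'M[k]_(n, p)) : (p < n)%N ->
  exists2 v : 'rV_n, v *m M = 0 & v != 0.
Proof.
move=> ltpn; have : kermx M != 0.
  by rewrite kermx_eq0 /row_free neq_ltn (leq_ltn_trans (rank_leq_col M)).
by case/rowV0Pn => v /sub_kermxP vM v0; exists v.
Qed.

(** If d > a, the N^d power products are independent modulo J, yet their degrees are at most d N b,
    where the number of face monomials grows only like N^a. *)
Lemma weakly_regular_size D J fs a : simplicial D ->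
  (forall S, D S -> (#|S| <= a)%N) ->
  is_ideal J -> (forall g, sr_ideal D g -> J g) ->
  weakly_regular J fs -> (size fs <= a)%N.
Proof.
move=> simD Da idJ DJ reg; rewrite leqNgt; apply/negP => lt_a.
set d := size fs in lt_a.
pose b := \max_(f <- fs) msize f.
have fsb f : f \in fs -> degree_le f b.
  move=> ffs u /msize_mdeg_lt /ltnW /leq_trans; apply.
  by apply: leq_bigmax_seq.
(* For this N, 2^m (d N b + 1)^a <= 2^m (d b + 1)^a N^a < N^(a + 1) <= N^d. *)
pose N := (2 ^ m * (d * b).+1 ^ a).+1.
pose deg := (d * (N * b))%N.
have lt_card : (#|face_monos D deg| < #|exponents N d|)%N.
  apply: (leq_ltn_trans (card_face_monos _ Da)); rewrite card_exponents.
  apply: (@leq_ltn_trans (2 ^ m * (d * b).+1 ^ a * N ^ a)).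
    rewrite -mulnA -expnMn leq_mul2l; apply/orP; right.
    have le_deg : (deg.+1 <= (d * b).+1 * N)%N.
      by rewrite /deg mulSn -mulnA [(N * b)%N]mulnC addnC -addn1 leq_add2l.
    by case: (a) => // e; rewrite leq_exp2r.
  apply: (@leq_trans (N ^ a.+1)); last by rewrite leq_pexp2l.
  by rewrite expnS ltn_pmul2r ?expn_gt0.
(* A kernel vector gives a combination of power products without face monomials, hence an element of
   [sr_ideal D]. *)
pose M := \matrix_(i < #|exponents N d|, j < #|face_monos D deg|)
  (@power_product k m N fs (enum_val i))@_(val (enum_val j)).
have [v vM /negP v0] := wide_kernel M lt_card.
pose c e := v 0 (enum_rank e).
apply: v0; apply/eqP/rowP => i; rewrite mxE -(enum_valK i).
apply: (weakly_regular_free idJ reg (c := c)); apply: DJ => u Du.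
rewrite raddf_sum /=.
have [ltu|leu] := ltnP (mdeg u) deg.+1.
  have uD : BMultinom ltu \in face_monos D deg by rewrite inE.
  have := congr1 (fun x : 'rV_ _ => x 0 (enum_rank_in uD (BMultinom ltu))) vM.
  rewrite !mxE => vM0; rewrite -[RHS]vM0.
  transitivity (\sum_(e in predT) (c e *: @power_product k m N fs e)@_u) => //.
  rewrite big_enum_val; apply: eq_bigr => j _.
  by rewrite mcoeffZ /c enum_valK mxE enum_rankK_in.
rewrite big1 // => e _; rewrite mcoeffZ memN_msupp_eq0 ?mulr0 //.
by apply: contraL leu => /(power_product_degree fsb); rewrite -ltnNge ltnS.
Qed.

End Counting.

(** * Krull dimension and depth in terms of faces *)

Section CohenMacaulay.
Variables (k : fieldType) (m : nat).
Local Notation R := {mpoly k[m]}.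
Variables (I : idealr R) (D : {set 'I_m} -> bool).
Hypothesis simD : simplicial D.
Hypothesis I_sr : forall g, g \in I <-> sr_ideal D g.
Local Notation Q := {ideal_quot I}.

Let pullback (P : {pred Q}) : R -> Prop := fun g => \pi_Q g \in P.

Lemma pullback_ideal P : idealr_closed P -> is_ideal (pullback P).
Proof.
case=> P0 _ PD; split; first by rewrite /pullback rmorph0.
by move=> a x y Px Py; rewrite /pullback rmorphD rmorphM; apply: PD.
Qed.

(** An element of the next prime outside the current one is a nonzerodivisor modulo the current
    one. *)
Lemma prime_chain_weakly_regular d P : prime_chain d P ->
  exists fs : seq R, size fs = d /\ weakly_regular (pullback (P 0%N)) fs.
Proof.
elim: d P => [|d IH] P [primeP incP].
  exists [::]; split=> //= P1; case: (primeP 0%N isT) => -[_ /negP n1 _] _.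
  by apply: n1; rewrite -(rmorph1 (\pi_Q)).
have [|fs [fsd reg]] := IH (fun i => P i.+1).
  by split=> i lti; [apply: (primeP i.+1) | apply: (incP i.+1)].
have [sub01 nsub10] := incP 0%N isT.
have [q q1 q0] : exists2 q, q \in P 1%N & q \notin P 0%N.
  apply: contrapT => nq; apply: nsub10 => q q1; apply: contrapT => /negP q0.
  by apply: nq; exists q.
exists (repr q :: fs); split; first by rewrite /= fsd.
split=> [g|]; last first.
  exists (pullback (P 1%N)); split=> //; last by rewrite /pullback reprK.
    by apply: pullback_ideal; case: (primeP 1%N isT).
  by move=> g; apply: sub01.
rewrite /pullback rmorphM /= reprK => qg; have [_ pr0] := primeP 0%N isT.
by case/orP: (pr0 _ _ qg) => // qP; rewrite qP in q0.
Qed.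

Lemma prime_chain_le a d P : (forall S, D S -> (#|S| <= a)%N) ->
  @prime_chain Q d P -> (d <= a)%N.
Proof.
move=> Da chP; have [fs [<- reg]] := prime_chain_weakly_regular chP.
have [idP _] := chP.1 0%N isT.
have idJ := pullback_ideal idP.
apply: (weakly_regular_size simD Da idJ _ reg) => g /I_sr /pi_ideal_eq0 gI.
by rewrite /pullback gI; case: idP.
Qed.

Lemma regular_sequence_le a (fs : seq R) : (forall S, D S -> (#|S| <= a)%N) ->
  regular_sequence [seq \pi_Q f | f <- fs] -> (size fs <= a)%N.
Proof.
move=> Da /regular_sequence_pi reg.
have idI : is_ideal (fun g => g \in I).
  have -> : (fun g => g \in I : Prop) = sr_ideal D.
    by apply/funext => g; apply/propext/I_sr.
  exact: sr_ideal_ideal.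
apply: (weakly_regular_size simD Da idI _ (regularW idI reg)).
by move=> g /I_sr.
Qed.

(** The image of the prime generated by the variables outside [W]. For a face [W] that prime
    contains [I], so the choice of representative does not matter. *)
Let face_prime (W : {set 'I_m}) : {pred Q} :=
  fun q => `[< sr_ideal (sr_simplex W) (repr q) >].

Lemma face_primeE W g : D W ->
  (\pi_Q g \in face_prime W) <-> sr_ideal (sr_simplex W) g.
Proof.
move=> DW; have idW := sr_ideal_ideal k (@simplicial_simplex m W).
have repW : sr_ideal (sr_simplex W) (g - repr (\pi_Q g)).
  move=> u uW; have : g - repr (\pi_Q g) \in I.
    by rewrite Quotient.idealrBE reprK.
  by move/I_sr; apply; apply: simD DW.
split=> [/asboolP|] Wg; first exact: (idealBr idW repW).
by apply/asboolP; apply: (idealBl idW repW).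
Qed.

Lemma face_prime_prime W : D W -> prime_ideal (face_prime W).
Proof.
move=> DW; have [id0 idD] := sr_ideal_ideal k (@simplicial_simplex m W).
have E g := face_primeE g DW.
split; first split.
- by rewrite -(rmorph0 (\pi_Q)); apply/E.
- rewrite -(rmorph1 (\pi_Q)); apply/negP => /E; apply: sr_ideal_proper.
  exact: sub0set.
- move=> a x y; rewrite -[a]reprK -[x]reprK -[y]reprK => /E Wx /E Wy.
  by rewrite -rmorphM -rmorphD; apply/E/idD.
move=> x y; rewrite -[x]reprK -[y]reprK -rmorphM => /E /sr_simplex_prime.
by case=> /E ->; rewrite ?orbT.
Qed.

(** Discarding the vertices of [W] one at a time shrinks the simplex and enlarges its prime. *)
Lemma face_prime_chain W : D W -> exists P, @prime_chain Q #|W| P.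
Proof.
move=> DW; pose V i := [set v in drop i (enum W)].
have VW i : V i \subset W.
  by apply/subsetP => v; rewrite inE => /mem_drop; rewrite mem_enum.
have DV i : D (V i) by apply: simD DW.
exists (fun i => face_prime (V i)); split=> [i _|i ltiW].
  exact: face_prime_prime.
have Vsub : V i.+1 \subset V i.
  apply/subsetP => v; rewrite !inE -add1n -drop_drop; exact: mem_drop.
split=> [q|].
  rewrite -[q]reprK => /face_primeE E; apply/face_primeE => // u uV.
  by apply: E => //; apply: subset_trans uV Vsub.
have ltie : (i < size (enum W))%N by rewrite -cardE.
have [v0 _] : exists v, v \in W by apply/set0Pn; rewrite -card_gt0; case: #|W| ltiW.
pose v := nth v0 (enum W) i.
have dropE := drop_nth v0 ltie.
have vV : v \in V i by rewrite inE dropE mem_head.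
have vV' : v \notin V i.+1.
  have : uniq (drop i (enum W)) by apply/drop_uniq/enum_uniq.
  by rewrite dropE /= inE => /andP [].
move/(_ (\pi_Q 'X_v)) => sub.
have /face_primeE : \pi_Q 'X_v \in face_prime (V i).
  apply: sub; apply/face_primeE => // u uV; rewrite mcoeffX; case: eqP => // uE.
  by move: uV; rewrite -uE mono_suppU /sr_simplex sub1set (negPf vV').
move/(_ (DV i) U_(v)%MM); rewrite mono_suppU /sr_simplex sub1set vV.
by rewrite mcoeffX eqxx => /(_ isT) /eqP; rewrite oner_eq0.
Qed.

Lemma cohen_macaulay_regular : cohen_macaulay_quotient I ->
  exists fs : seq R, [/\ {subset fs <= @irrelevant_ideal k m},
    regular (sr_ideal D) fs & forall W, D W -> (#|W| <= size fs)%N].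
Proof.
case=> d [[_ dim_max] [[fs [fsd fs_irr /regular_sequence_pi reg]] _]].
exists fs; split=> //; last first.
  by move=> W /face_prime_chain /dim_max; rewrite fsd.
have <- // : (fun g => g \in I : Prop) = sr_ideal D.
by apply/funext => g; apply/propext/I_sr.
Qed.

Lemma regular_cohen_macaulay (fs : seq R) :
  {subset fs <= @irrelevant_ideal k m} -> regular (sr_ideal D) fs ->
  (forall W, D W -> (#|W| <= size fs)%N) -> (0 < size fs)%N ->
  cohen_macaulay_quotient I.
Proof.
move=> fs_irr reg Dle fs_gt0.
have regQ : regular_sequence [seq \pi_Q f | f <- fs].
  apply/regular_sequence_pi.
  have -> // : (fun g => g \in I : Prop) = sr_ideal D.
  by apply/funext => g; apply/propext/I_sr.
(* Some face has as many vertices as [fs] has elements: otherwise all faces would be smaller, and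
   [fs] would violate the bound on regular sequences. *)
have [W DW Wd] : exists2 W, D W & #|W| = size fs.
  apply: contrapT => nW.
  suff : (size fs <= (size fs).-1)%N by case: (size fs) fs_gt0 => // n _; rewrite ltnn.
  apply: regular_sequence_le regQ => S DS.
  rewrite -ltnS prednK // ltn_neqAle Dle // andbT.
  by apply/eqP => Sd; apply: nW; exists S.
exists (size fs); split; split.
- by rewrite -Wd; apply: face_prime_chain.
- by move=> d [P chP]; apply: prime_chain_le chP.
- by exists fs.
- by move=> d [gs [<- _ reg']]; apply: regular_sequence_le reg'.
Qed.

End CohenMacaulay.

(** * Cohen-Macaulay graphs *)
Section EdgeIdeals.
Variables (k : fieldType) (m : nat) (G : simple_graph m).
Local Notation R := {mpoly k[m]}.
Implicit Types (S T W : {set 'I_m}).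

Definition independent S := [forall i in S, forall j in S, ~~ G i j].

Lemma independentP S :
  reflect {in S &, forall i j, ~~ G i j} (independent S).
Proof.
apply: (iffP forall_inP) => [H i j iS jS|H i iS].
  by have /forall_inP := H i iS; apply.
by apply/forall_inP => j jS; apply: H.
Qed.

Lemma simplicial_independent : simplicial independent.
Proof.
move=> S T /subsetP ST /independentP indT; apply/independentP => i j iS jS.
by apply: indT; apply: ST.
Qed.

Lemma edge_ideal_sr (g : R) : g \in @edge_ideal k m G <-> sr_ideal independent g.
Proof.
have idE : is_ideal (fun g => g \in @edge_ideal k m G).
  exact: generated_ideal_ideal.
split.
  apply: generated_ideal_min.
    exact: sr_ideal_ideal simplicial_independent.
  move=> _ [i [j [Gij ->]]] u /independentP ind_u.
  rewrite -mpolyXD mcoeffX; case: eqP => // uE; move: (ind_u i j).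
  by rewrite -uE mono_suppD !mono_suppU !inE !eqxx orbT Gij => /(_ isT isT).
move=> Dg; rewrite [g]mpolyE; rewrite big_seq; apply: (ideal_sum idE) => u ug.
rewrite -mul_mpolyC; apply: (idealMl idE).
have : ~~ independent (mono_supp u).
  by apply: contraL ug => /Dg /eqP; rewrite mcoeff_eq0.
case/forall_inPn => i iu /forall_inPn [j ju]; rewrite negbK => Gij.
have le_u : (U_(i) + U_(j) <= u)%MM.
  apply/mnm_lepP => v; rewrite mnmDE !mnm1E.
  have ij : i != j by apply: contraTneq Gij => ->; rewrite edge_irr.
  rewrite !inE in iu ju; case: eqP => [<-|_].
    by rewrite eq_sym (negPf ij) addn0 lt0n.
  by case: eqP => // <-; rewrite add0n lt0n.
rewrite -(submK le_u) mpolyXD; apply: (idealMl idE).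
by apply: generated_ideal_gen; exists i, j; rewrite mpolyXD.
Qed.

End EdgeIdeals.

(** * Obstructions to the Cohen-Macaulay property of a graph *)

Section GraphObstructions.
Variables (k : fieldType) (m : nat) (G : simple_graph m).
Implicit Types (S T W F C : {set 'I_m}).

Definition coboundary (r : 'I_m -> nat) (f : {set 'I_m} -> k) S : k :=
  \sum_(v in S) (-1) ^+ koszul_sign r v S * f (S :\ v).

(** Being first, [v] carries a plus sign and flips the sign of every other vertex. *)
Lemma coboundaryU1 (r : 'I_m -> nat) f v S : (forall u, u \in S -> (r v < r u)%N) ->
  coboundary r f (v |: S) = f S - coboundary r (fun T => f (v |: T)) S.
Proof.
move=> vS; have nvS : v \notin S by apply/negP => /vS; rewrite ltnn.
have sign_v : koszul_sign r v S = false.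
  rewrite /koszul_sign (_ : [set u in S | _] = set0) ?cards0 //.
  apply/setP => u; rewrite !inE; apply/andP => -[/vS ltvu].
  by apply/negP; rewrite -leqNgt ltnW.
rewrite /coboundary big_setU1 //= koszul_signU // ltnn addbF sign_v mul1r.
rewrite setU1K // -sumrN; congr (_ + _); apply: eq_bigr => u uS.
rewrite koszul_signU // vS // addbT !mulr_sign if_neg.
have -> : (v |: S) :\ u = v |: (S :\ u).
  by apply/setP => w; rewrite !inE; case: eqP => // ->; case: eqP => // vu;
    rewrite -vu uS in nvS.
by case: koszul_sign; rewrite ?opprK.
Qed.

Lemma coboundary0 r f : coboundary r f set0 = 0.
Proof. by rewrite /coboundary big_set0. Qed.

Lemma coboundary1 r f v : coboundary r f [set v] = f set0.
Proof.
by rewrite -[[set v]]setU0 coboundaryU1 ?coboundary0 ?subr0 // => u; rewrite inE.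
Qed.

Lemma coboundary2 (r : 'I_m -> nat) f u v : (r u < r v)%N ->
  coboundary r f [set u; v] = f [set v] - f [set u].
Proof.
move=> uv; rewrite coboundaryU1 ?coboundary1 ?setU0 // => w.
by rewrite inE => /eqP ->.
Qed.

Lemma coboundary3 (r : 'I_m -> nat) f u v w : (r u < r v)%N -> (r v < r w)%N ->
  coboundary r f (u |: [set v; w]) = f [set v; w] - f [set u; w] + f [set u; v].
Proof.
move=> uv vw; rewrite coboundaryU1 ?coboundary2 // ?opprB ?addrA; last first.
  by move=> z; rewrite !inE => /orP [] /eqP -> //; apply: ltn_trans vw.
by rewrite addrAC.
Qed.

Lemma rank_min (r : 'I_m -> nat) T n : injective r -> #|T| = n.+1 ->
  exists v S, [/\ T = v |: S, #|S| = n & forall u, u \in S -> (r v < r u)%N].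
Proof.
move=> r_inj Tn; have [v0 v0T] : exists v, v \in T.
  by apply/set0Pn; rewrite -card_gt0 Tn.
have [v /= vT vmin] := @arg_minnP _ v0 (fun v => v \in T) r v0T.
exists v, (T :\ v); rewrite setD1K //; split=> //.
  by apply/eqP; rewrite -eqSS -Tn (cardsD1 v T) vT.
move=> u /setD1P [uv /vmin]; rewrite leq_eqVlt => /predU1P [/r_inj vu|//].
by rewrite vu eqxx in uv.
Qed.

Lemma sorted_pair (r : 'I_m -> nat) T : injective r -> #|T| = 2 ->
  exists u v, T = [set u; v] /\ (r u < r v)%N.
Proof.
move=> r_inj /(rank_min r_inj) [u [S [-> /eqP/cards1P [v ->] uS]]].
by exists u, v; split=> //; apply: uS; rewrite inE.
Qed.

Lemma sorted_triple (r : 'I_m -> nat) T : injective r -> #|T| = 3 ->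
  exists u v w, [/\ T = u |: [set v; w], (r u < r v)%N & (r v < r w)%N].
Proof.
move=> r_inj /(rank_min r_inj) [u [S [-> S2 uS]]].
have [v [w [SE vw]]] := sorted_pair r_inj S2.
by exists u, v, w; rewrite SE; split=> //; apply: uS; rewrite SE !inE eqxx.
Qed.

Hypothesis cmG : cohen_macaulay_graph k G.

Let cm_regular := cohen_macaulay_regular (@simplicial_independent m G)
  (@edge_ideal_sr k m G) cmG.

Lemma cohen_macaulay_unmixed F W : independent G F ->
  (forall S, independent G S -> F \subset S -> S = F) ->
  independent G W -> (#|W| <= #|F|)%N.
Proof.
move=> indF maxF indW; have [fs [fs_irr reg fs_max]] := cm_regular.
rewrite leqNgt; apply/negP => ltFW.
have [||psi] := @sr_obstruction k m _ (@ord_inj m) (independent G) F fs #|F|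
  (fun=> 1) (@simplicial_independent m G) reg fs_irr.
- exact: leq_trans ltFW (fs_max W indW).
- by move=> S indS FS; rewrite (maxF S) // => /eqP; rewrite eqn_leq ltnn andbF.
move/(_ F indF (subxx F) erefl); rewrite setDv big_set0 => /eqP.
by rewrite oner_eq0.
Qed.

(* Joining with a maximal independent set of the other components turns a
   cohomology class of one component into an obstruction. *)
Lemma cohen_macaulay_component C (r : 'I_m -> nat) c (f : {set 'I_m} -> k) T0 :
  (forall u v, u \in C -> v \notin C -> ~~ G u v) ->
  injective r -> (forall u v, u \in C -> v \notin C -> (r u < r v)%N) ->
  T0 \subset C -> independent G T0 -> #|T0| = c.+1 ->
  (forall T, T \subset C -> independent G T -> #|T| = c.+1 ->
    coboundary r f T = 0) ->
  exists g, forall T, T \subset C -> independent G T -> #|T| = c ->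
    f T = coboundary r g T.
Proof.
move=> isoC r_inj rC T0C indT0 T0c cocycle.
have [fs [fs_irr reg fs_max]] := cm_regular.
have ind0 : independent G set0 by apply/independentP => i j; rewrite inE.
(* As [H] is maximal among the independent sets outside [C], a face containing it is [H] joined with
   an independent subset of [C]. *)
have [H /maxsetP [/andP [indH HC] maxH] _] := @maxset_exists _
  (fun S => independent G S && (S \subset ~: C)) set0
  (introT andP (conj ind0 (sub0set _))).
have indU T : T \subset C -> independent G T -> independent G (H :|: T).
  move=> /subsetP TC /independentP indT; apply/independentP => i j.
  move/independentP in indH; move/subsetP in HC.
  have HCn v : v \in H -> v \notin C by move/HC; rewrite inE.
  case/setUP => iS /setUP [] jS; [exact: indH| |exact: isoC (TC _ iS) (HCn _ jS)
    |exact: indT].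
  by rewrite edge_sym; apply: isoC (TC _ jS) (HCn _ iS).
have splitS S : independent G S -> H \subset S -> S :\: H = S :&: C.
  move=> indS HS; have SH : S :\: C = H.
    apply: maxH; first by rewrite (simplicial_independent (subsetDl _ C)) //
      setDE subsetIr.
    apply/subsetP => v vH; rewrite inE (subsetP HS) // andbT.
    by move/subsetP: HC => /(_ v vH); rewrite inE.
  by rewrite -{1}SH setDDr setDv set0U.
have disH T : T \subset C -> [disjoint H & T].
  by move=> TC; rewrite (disjointWr TC) // disjoints_subset.
have cardU T : T \subset C -> #|H :|: T| = (#|H| + #|T|)%N.
  by move=> TC; rewrite cardsU (disjoint_setI0 (disH T TC)) cards0 subn0.
(* The rank puts [C] first, so vertices outside [C] do not affect these signs. *)
have sign_eq S v : v \in C -> koszul_sign r v S = koszul_sign r v (S :&: C).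
  move=> vC; congr odd; apply: eq_card => u; rewrite !inE.
  have [uC|uC] := boolP (u \in C); first by rewrite andbT.
  by rewrite andbF ltnNge (ltnW (rC _ _ vC uC)) andbF.
(* The cochain of the component is pulled back along intersection with [C]; the face formed by [H]
   and [T0] keeps the degree below the length of [fs]. *)
have [||g gP] := @sr_obstruction k m r r_inj (independent G) H fs (#|H| + c)
  (fun S => f (S :&: C)) (@simplicial_independent m G) reg fs_irr.
- by rewrite -addnS -T0c -cardU //; apply/fs_max/indU.
- move=> S indS HS Sc; have SC := splitS S indS HS.
  have indSC : independent G (S :&: C).
    exact: simplicial_independent (subsetIl _ _) indS.
  rewrite SC -[RHS](cocycle (S :&: C)) ?subsetIr //; last first.
    apply/eqP; rewrite -(eqn_add2l #|H|) -cardU ?subsetIr // addnS -Sc -SC.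
    by rewrite setDE setUIr setUCr setIT (setUidPr HS).
  apply: eq_bigr => v /setIP [vS vC]; rewrite sign_eq //; congr (_ * f _).
  by apply/setP => u; rewrite !inE andbA.
exists (fun T => g (H :|: T)) => T TC indT Tc.
have := gP (H :|: T) (indU T TC indT) (subsetUl _ _).
rewrite cardU // Tc => /(_ erefl).
have HTC : (H :|: T) :&: C = T.
  rewrite setIUl (setIidPl TC); apply/setUidPr.
  by rewrite disjoint_setI0 ?sub0set // disjoints_subset.
have HTH : (H :|: T) :\: H = T.
  rewrite setDUl setDv set0U; apply/setDidPl; rewrite disjoint_sym.
  exact: disH.
rewrite HTC HTH => ->; apply: eq_bigr => v vT.
rewrite sign_eq ?(subsetP TC) // HTC; congr (_ * g _).
apply/setP => u; rewrite !inE; case: eqP => //= ->; rewrite orbF.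
have := disH T TC; rewrite disjoint_sym => /disjointFr -> //.
Qed.

(* [F] contains the centre of a claw isolated by [p] and [q]; trading the
   centre for the leaves gives a larger independent set. *)
Lemma cohen_macaulay_no_isolated_claw c u v w p q :
  ~~ G c p -> ~~ G c q -> ~~ G p q ->
  G c u -> G c v -> G c w -> uniq [:: u; v; w] ->
  ~~ G u v -> ~~ G u w -> ~~ G v w ->
  ~ forall x y, x \in [:: u; v; w] -> G x y -> [|| y == c, G y p | G y q].
Proof.
move=> cp cq pq cu cv cw; rewrite /= !inE negb_or -!andbA andbT.
case/and3P=> nuv nuw nvw uv uw vw iso.
have ind_cpq : independent G [set c; p; q].
  apply/independentP => x y; rewrite !inE -!orbA.
  case/or3P => /eqP ->; case/or3P => /eqP ->; rewrite ?edge_irr //;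
  by rewrite edge_sym.
have [F /maxsetP [indF maxF]] := maxset_exists ind_cpq.
rewrite !subUset !sub1set => /andP [/andP [cF pF] qF].
have indFP := independentP _ _ indF.
have nF z : [|| G c z, G z p | G z q] -> z \notin F.
  by apply: contraTN => zF; rewrite !(negPf (indFP _ _ _ _)).
(* A neighbour of a leaf other than [c] is adjacent to [p] or [q], which lie in [F]. *)
have nadj x y : x \in [:: u; v; w] -> y \in F :\ c -> ~~ G x y.
  move=> xl /setD1P [yc yF]; apply: contraL yF => Gxy; apply: nF.
  by have := iso x y xl Gxy; rewrite (negPf yc) /= => ->; rewrite orbT.
pose L := [set u; v; w].
have Ll x : x \in L -> x \in [:: u; v; w] by rewrite !inE -orbA.
have indL : {in L &, forall x y, ~~ G x y}.
  move=> x y; rewrite !inE -!orbA.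
  case/or3P => /eqP ->; case/or3P => /eqP ->; rewrite ?edge_irr //;
  by rewrite edge_sym.
have LF x : x \in L -> x \notin F.
  by rewrite !inE -orbA => /or3P [] /eqP ->; apply: nF; rewrite ?cu ?cv ?cw.
(* Three leaves replace one centre, so this set has two elements more than [F]. *)
have indW : independent G (L :|: F :\ c).
  apply/independentP => x y; case/setUP => xW; case/setUP => yW.
  - exact: indL.
  - by apply: nadj => //; apply: Ll.
  - by rewrite edge_sym; apply: nadj => //; apply: Ll.
  - by move: xW yW => /setD1P [_ xF] /setD1P [_ yF]; apply: indFP.
have maxF' S : independent G S -> F \subset S -> S = F.
  by move=> indS; apply: maxF.
have := cohen_macaulay_unmixed indF maxF' indW.
rewrite cardsU disjoint_setI0 ?cards0 ?subn0; last first.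
  rewrite disjoint_subset; apply/subsetP => x /LF xF.
  by rewrite !inE (negPf xF) andbF.
rewrite (cardsD1 c F) cF leq_add2r /L -setUA !cardsU1 cards1 !inE.
by rewrite (negPf nuv) (negPf nuw) (negPf nvw).
Qed.

End GraphObstructions.

(** * Cubic circulant graphs *)
Section CubicCirculant.
Local Open Scope nat_scope.
Variables (k : fieldType) (n a : nat).
Hypotheses (a_gt0 : 0 < a) (lt_an : a < n).
Local Notation G := (circulant (2 * n) [:: a; n]).

(** Adjacency in linear arithmetic, for [lia]; the last two cases wrap around. *)
Lemma cubic_edge (i j : 'I_(2 * n)) :
  G i j = [|| i == j + a :> nat, j == i + a :> nat, i == j + n :> nat,
    j == i + n :> nat, i + a == j + 2 * n | j + a == i + 2 * n].
Proof.
have := ltn_ord i; have := ltn_ord j.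
rewrite /edge /= /circulant_rel !inE -val_eqE /=.
have [le_ij|lt_ji] := leqP i j.
  by rewrite (distnEr le_ij) => *; apply/idP/idP; lia.
by rewrite (distnEl (ltnW lt_ji)) => *; apply/idP/idP; lia.
Qed.

Lemma vertex_of (x : nat) : x < 2 * n -> exists i : 'I_(2 * n), val i = x.
Proof. by move=> lt_x; exists (Ordinal lt_x). Qed.

(* Locally the graph is a ladder, in which [n - 2a] and [n + 2a] isolate the
   claw with centre [0]. *)
Lemma claw_not_cohen_macaulay :
  2 * a <> n -> 3 * a <> 2 * n -> 4 * a <> n -> 4 * a <> 3 * n ->
  5 * a <> 2 * n -> 5 * a <> 4 * n -> 3 * a <> n ->
  ~ cohen_macaulay_graph k G.
Proof.
move=> ne1 ne2 ne3 ne4 ne5 ne6 ne7 cmG.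
have n_gt0 : 0 < n by lia.
have [c cE] := @vertex_of 0 ltac:(lia).
have [u uE] := @vertex_of a ltac:(lia).
have [v vE] := @vertex_of (2 * n - a) ltac:(lia).
have [w wE] := @vertex_of n ltac:(lia).
(* These are n + 2a and n - 2a modulo 2n; which of them wraps around depends on whether 2a < n. *)
have [p [q pqE]] : exists p q : 'I_(2 * n),
    2 * a < n /\ val p = n + 2 * a /\ val q = n - 2 * a \/
    n < 2 * a /\ val p = 2 * a - n /\ val q = 3 * n - 2 * a.
  have [lt_an2|le_na2] := ltnP (2 * a) n.
    have [p pE] := @vertex_of (n + 2 * a) ltac:(lia).
    have [q qE] := @vertex_of (n - 2 * a) ltac:(lia).
    by exists p, q; left.
  have [p pE] := @vertex_of (2 * a - n) ltac:(lia).
  have [q qE] := @vertex_of (3 * n - 2 * a) ltac:(lia).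
  by exists p, q; right; split=> //; lia.
simpl in *.
apply: (cohen_macaulay_no_isolated_claw cmG (c := c) (u := u) (v := v) (w := w)
  (p := p) (q := q)).
- rewrite cubic_edge; clear -a_gt0 lt_an cE pqE ne1 ne7; lia.
- rewrite cubic_edge; clear -a_gt0 lt_an cE pqE ne1 ne7; lia.
(* The two vertices differ by 4a, so an edge would make 3a or 5a a multiple of 2n, or 4a an odd
   multiple of n. *)
- rewrite cubic_edge; clear -a_gt0 lt_an pqE ne2 ne3 ne4 ne5 ne6; lia.
- rewrite cubic_edge; clear -a_gt0 lt_an cE uE; lia.
- rewrite cubic_edge; clear -a_gt0 lt_an cE vE; lia.
- rewrite cubic_edge; clear -a_gt0 lt_an cE wE; lia.
- rewrite /= !inE -!val_eqE /=; clear -a_gt0 lt_an uE vE wE; lia.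
- rewrite cubic_edge; clear -a_gt0 lt_an uE vE ne1 ne2; lia.
- rewrite cubic_edge; clear -a_gt0 lt_an uE wE ne1; lia.
- rewrite cubic_edge; clear -a_gt0 lt_an vE wE ne1; lia.
have y_c (y : 'I_(2 * n)) : val y = 0 -> y == c.
  by move=> y0; apply/eqP/val_inj; rewrite /= cE.
(* Besides the centre, the leaves a, -a and n have the neighbours n + a, 2a, n - a and -2a; [p] is
   adjacent to the first two, [q] to the last two. *)
have near_p (y : 'I_(2 * n)) : (val y = n + a \/ val y = a + a) -> G y p.
  rewrite cubic_edge /= => H; clear -a_gt0 lt_an pqE H; lia.
have near_q (y : 'I_(2 * n)) : (val y = n - a \/ val y = 2 * n - (a + a)) -> G y q.
  rewrite cubic_edge /= => H; clear -a_gt0 lt_an pqE H; lia.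
move=> x y; rewrite !inE => /or3P [] /eqP -> Gxy; have lty := ltn_ord y.
- have [/y_c ->//|/near_p ->] : val y = 0 \/
    (val y = n + a \/ val y = a + a); last by rewrite orbT.
  move: Gxy; rewrite cubic_edge /= => H; clear -a_gt0 lt_an uE lty H; lia.
- have [/y_c ->//|/near_q ->] : val y = 0 \/
    (val y = n - a \/ val y = 2 * n - (a + a)); last by rewrite !orbT.
  move: Gxy; rewrite cubic_edge /= => H; clear -a_gt0 lt_an vE lty H; lia.
- have [/y_c ->//|[yE|yE]] : val y = 0 \/ val y = n + a \/ val y = n - a.
  + move: Gxy; rewrite cubic_edge /= => H; clear -a_gt0 lt_an wE lty H; lia.
  + by rewrite near_p ?orbT //; left.
  + by rewrite near_q ?orbT //; left.
Qed.

End CubicCirculant.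

(** * Splitting the graph into smaller circulants *)

Section Components.
Local Open Scope nat_scope.
Variables (L x a0 n a : nat).
Hypotheses (x_gt0 : 0 < x) (a0_gt0 : 0 < a0) (lt_a0 : a0 < L./2).
Hypothesis evenL : ~~ odd L.
Hypotheses (aE : a = a0 * x) (nE : n = L./2 * x).
Local Notation G := (circulant (2 * n) [:: a; n]).

(* The graph is a union of [x] circulants on [L] points: [p * x + q] with
   [q < x] is the point [p] of the component [q]. *)
Definition component_edge (p q : nat) :=
  [|| p == q + a0, q == p + a0, p == q + L./2, q == p + L./2,
      p + a0 == q + L | q + a0 == p + L].

Lemma order_components : 2 * n = L * x.
Proof. by rewrite nE mulnA mul2n halfK (negPf evenL) subn0. Qed.

Lemma component_edgeE (i j : 'I_(2 * n)) :
  G i j = (i %% x == j %% x) && component_edge (i %/ x) (j %/ x).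
Proof.
have shift e (y z : nat) : (y == z + e * x) =
    (y %% x == z %% x) && (y %/ x == z %/ x + e).
  apply/eqP/andP => [->|[/eqP yz /eqP yze]].
    by rewrite addnC modnMDl divnMDl // addnC !eqxx.
  by rewrite (divn_eq y x) yz yze mulnDl addnAC -divn_eq.
have shift2 e e' (y z : nat) : (y + e * x == z + e' * x) =
    (y %% x == z %% x) && (y %/ x + e == z %/ x + e').
  by rewrite shift addnC modnMDl divnMDl // [e + _]addnC.
rewrite cubic_edge; [|by rewrite aE muln_gt0 a0_gt0|by rewrite aE nE ltn_pmul2r].
move: (nat_of_ord i) (nat_of_ord j) => y z.
rewrite order_components aE nE !shift2 !shift ![z %% x == _]eq_sym.
by rewrite -!andb_orr.
Qed.

End Components.

Lemma independent2 m (G : simple_graph m) u v :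
  ~~ G u v -> independent G [set u; v].
Proof.
move=> uv; apply/independentP => i j; rewrite !inE.
by case/orP => /eqP ->; case/orP => /eqP ->; rewrite ?edge_irr // edge_sym.
Qed.

(** * Components with cohomology in low degree *)

Section ComponentObstructions.
Local Open Scope nat_scope.
Variables (k : fieldType) (L x a0 n a : nat).
Hypotheses (x_gt0 : 0 < x) (a0_gt0 : 0 < a0) (lt_a0 : a0 < L./2).
Hypothesis evenL : ~~ odd L.
Hypotheses (aE : a = a0 * x) (nE : n = L./2 * x).
Local Notation G := (circulant (2 * n) [:: a; n]).
Local Notation edgeE := (component_edgeE x_gt0 a0_gt0 lt_a0 evenL aE nE).
Local Notation adj := (component_edge L a0).

Let C : {set 'I_(2 * n)} := [set i : 'I_(2 * n) | i %% x == 0].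

Lemma vertex_in_component p : p < L ->
  exists i : 'I_(2 * n), [/\ val i = p * x, i \in C & i %/ x = p].
Proof.
move=> ltpL; have lt_px : p * x < 2 * n.
  by rewrite (order_components evenL nE) ltn_pmul2r.
by exists (Ordinal lt_px); rewrite inE /= modnMl mulnK.
Qed.

Lemma component_index (i : 'I_(2 * n)) : i %/ x < L.
Proof. by rewrite ltn_divLR // -(order_components evenL nE). Qed.

Lemma component_isolated u v : u \in C -> v \notin C -> ~~ G u v.
Proof.
rewrite !inE => /eqP u0 v0; rewrite edgeE u0; apply: contra v0 => /andP [].
by rewrite eq_sym.
Qed.

Lemma component_nonedge u v (T : {set 'I_(2 * n)}) :
  T \subset C -> independent G T -> u \in T -> v \in T -> ~~ adj (u %/ x) (v %/ x).
Proof.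
move=> /subsetP TC /independentP indT uT vT; have := indT u v uT vT.
have := TC u uT; have := TC v vT; rewrite !inE edgeE => /eqP -> /eqP ->.
by rewrite eqxx.
Qed.

Lemma component_edge_in u v : u \in C -> v \in C -> G u v = adj (u %/ x) (v %/ x).
Proof. by rewrite !inE edgeE => /eqP -> /eqP ->; rewrite eqxx. Qed.

(** On [C] this is the position after multiplication by [w] modulo [L]; the offset [L] puts all
    other vertices later. *)
Definition component_rank (w : nat) (i : 'I_(2 * n)) : nat :=
  if i %% x == 0 then (w * (i %/ x)) %% L else L + i.

Lemma component_rank_in w i : i \in C ->
  component_rank w i = (w * (i %/ x)) %% L.
Proof. by rewrite /component_rank inE => ->. Qed.

Lemma component_rank_inj w w' :
  all (fun p => (w' * ((w * p) %% L)) %% L == p) (iota 0 L) ->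
  injective (component_rank w).
Proof.
move=> /allP ww' i j; have L_gt0 : 0 < L by lia.
have K (l : 'I_(2 * n)) : (w' * ((w * (l %/ x)) %% L)) %% L = l %/ x.
  by apply/eqP/ww'; rewrite mem_iota component_index.
rewrite /component_rank; case: eqP => i0; case: eqP => j0 e.
- apply: val_inj; rewrite /= (divn_eq i x) (divn_eq j x) i0 j0 -(K i) -(K j).
  by rewrite e.
- by have := ltn_pmod (w * (i %/ x)) L_gt0; lia.
- by have := ltn_pmod (w * (j %/ x)) L_gt0; lia.
- by apply: val_inj => /=; lia.
Qed.

Lemma component_rank_lt w u v : u \in C -> v \notin C ->
  component_rank w u < component_rank w v.
Proof.
move=> uC; rewrite component_rank_in // /component_rank inE => /negPf ->.
by apply: leq_trans (leq_addr _ _); apply: ltn_pmod; lia.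
Qed.

(* The independence complex of the component is disconnected. *)
Lemma bipartite_not_cohen_macaulay : 2 < L ->
  all (fun p => all (fun q => (odd p == odd q) || adj p q) (iota 0 L)) (iota 0 L) ->
  ~~ adj 0 2 -> ~ cohen_macaulay_graph k G.
Proof.
move=> L_gt2 /allP bip adj02 cmG.
have inI p : p < L -> p \in iota 0 L by rewrite mem_iota.
have parity p q : p < L -> q < L -> ~~ adj p q -> odd p = odd q.
  move=> pL qL npq; have /allP/(_ q (inI q qL)) := bip p (inI p pL).
  by rewrite (negPf npq) orbF => /eqP.
have [v0 [v0E v0C d0]] := @vertex_in_component 0 ltac:(lia).
have [v1 [v1E v1C d1]] := @vertex_in_component 1 ltac:(lia).
have [v2 [v2E v2C d2]] := @vertex_in_component 2 L_gt2.
have r_inj : injective (component_rank 1).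
  apply: (component_rank_inj (w' := 1)); apply/allP => p; rewrite mem_iota => pL.
  by rewrite !mul1n !modn_mod modn_small.
(* Parity agrees on nonadjacent vertices, hence is a cocycle. A coboundary would be constant on the
   component, but the points 0 and 1 differ in parity. *)
pose f (T : {set 'I_(2 * n)}) : k := ([exists v in T, odd (v %/ x)])%:R.
have f1 v : f [set v] = (odd (v %/ x))%:R.
  rewrite /f; congr _%:R; congr nat_of_bool; apply/exists_inP/idP => [[u]|odd_v].
    by rewrite inE => /eqP ->.
  by exists v; rewrite ?inE.
have [|||T TC indT T2|g gP] := @cohen_macaulay_component k _ G cmG C
  (component_rank 1) 1 f [set v0; v2] (@component_isolated) r_inj
  (@component_rank_lt 1).
- by rewrite subUset !sub1set v0C.
- by apply: independent2; rewrite component_edge_in // d0 d2.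
- by rewrite cards2 -val_eqE /= v0E v2E; lia.
- have [u [v [TE uv]]] := sorted_pair r_inj T2.
  rewrite TE coboundary2 // !f1 (parity (u %/ x) (v %/ x)) ?component_index ?subrr //.
  by apply: (component_nonedge TC indT); rewrite TE !inE eqxx ?orbT.
have gE v : v \in C -> (odd (v %/ x))%:R = g set0 :> k.
  move=> vC; rewrite -f1 gP ?coboundary1 ?sub1set ?cards1 //.
  by rewrite -[[set v]]setUid independent2 ?edge_irr.
have := gE v0 v0C; rewrite -(gE v1 v1C) d0 d1 /= => /eqP.
by rewrite eq_sym GRing.oner_eq0.
Qed.

Definition cyclically_near h y z :=
  (y <= z + h) && (z <= y + h) || (L <= y - z + h) || (L <= z - y + h).

(* Multiplication by [w], with inverse [w'], turns the component into a circle of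
   [L] points in which the nonadjacent ones are those at distance at most [h]. *)
Definition circle_data w w' h : bool :=
  [&& all (fun p => (w' * ((w * p) %% L)) %% L == p) (iota 0 L),
      all (fun p => all (fun q => adj p q ||
        cyclically_near h ((w * p) %% L) ((w * q) %% L)) (iota 0 L)) (iota 0 L),
      all (fun p => all (fun q => ~~ cyclically_near h p q || (p == q) ||
        ~~ adj ((w' * p) %% L) ((w' * q) %% L)) (iota 0 L)) (iota 0 L),
      all (fun p => (w * ((w' * p) %% L)) %% L == p) (iota 0 L),
      1 < h, 3 * h < L, L < 3 * h + 3 & L./2 == h + 2].

(* The independence complex of the component has the homotopy type of a
   circle; the class is the cocycle counting crossings of a base point. *)
Lemma circle_not_cohen_macaulay w w' h : circle_data w w' h ->
  ~ cohen_macaulay_graph k G.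
Proof.
case/and5P => ww' /allP near_w /allP near_w' /allP w'w.
case/and4P => h_gt1 lt_3h le_3h /eqP Lh cmG.
have inI p : p < L -> p \in iota 0 L by rewrite mem_iota.
have [L_gt0 [L_gt1 [L_gt2 [L_gth L_gt2h]]]] :
  0 < L /\ 1 < L /\ 2 < L /\ h < L /\ 2 * h < L by lia.
have near_le p q : p <= q -> q <= p + h -> cyclically_near h p q.
  by rewrite /cyclically_near => pq ->; rewrite (leq_trans pq) ?leq_addr.
have [lt01 [lt12 [lt23 lt03]]] :
  0 < h /\ h < 2 * h /\ 2 * h < 3 * h /\ 0 < 3 * h by lia.
have [near01 [near12 [near23 near03]]] : cyclically_near h 0 h /\
    cyclically_near h h (2 * h) /\ cyclically_near h (2 * h) (3 * h) /\
    cyclically_near h 0 (3 * h).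
  by do 3![split; first by apply: near_le; lia]; rewrite /cyclically_near; lia.
(* Near points differ by at most h or at least L - h = h + 4, so h + 2 separates ordinary edges from
   those crossing the base point. Since 3h < L, two ordinary steps never amount to a crossing. *)
have crossing p q s : p < q -> q < s -> s < L -> cyclically_near h p q ->
    cyclically_near h p s -> cyclically_near h q s ->
    (h + 2 < s - p) = (h + 2 < s - q) + (h + 2 < q - p) :> nat.
  by rewrite /cyclically_near; lia.
have [gap1 [gap2 [gap3 gap0]]] : (h + 2 < h - 0) = false /\
    (h + 2 < 2 * h - h) = false /\ (h + 2 < 3 * h - 2 * h) = false /\
    (h + 2 < 3 * h - 0) = true by lia.
have r_inj := component_rank_inj ww'.
set r := component_rank w in r_inj.
have r_near (T : {set 'I_(2 * n)}) u v : T \subset C -> independent G T ->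
    u \in T -> v \in T -> cyclically_near h (r u) (r v).
  move=> TC indT uT vT; rewrite /r !component_rank_in ?(subsetP TC) //.
  have /allP/(_ _ (inI _ (component_index v))) := near_w _ (inI _ (component_index u)).
  by rewrite (negPf (component_nonedge TC indT uT vT)).
have point p : p < L -> exists i : 'I_(2 * n), i \in C /\ r i = p /\
    i %/ x = (w' * p) %% L.
  move=> pL; have [|i [_ iC ip]] := @vertex_in_component ((w' * p) %% L).
    by rewrite ltn_pmod.
  exists i; split=> //; split=> //; rewrite /r component_rank_in // ip.
  by apply/eqP/w'w; rewrite mem_iota.
have nonedge u v p q : u \in C -> v \in C -> r u = p -> r v = q ->
    u %/ x = (w' * p) %% L -> v %/ x = (w' * q) %% L ->
    p < L -> q < L -> p != q -> cyclically_near h p q -> ~~ G u v.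
  move=> uC vC _ _ up vq pL qL pq npq; rewrite component_edge_in // up vq.
  have /allP/(_ q (inI q qL)) := near_w' p (inI p pL).
  by rewrite npq (negPf pq).
pose f (T : {set 'I_(2 * n)}) : k :=
  ([exists u in T, exists v in T, L./2 < r v - r u])%:R.
have f2 u v : r u < r v -> f [set u; v] = (L./2 < r v - r u)%:R.
  move=> uv; rewrite /f; congr _%:R; congr nat_of_bool.
  apply/exists_inP/idP => [[y + /exists_inP [z]]|jump].
    by rewrite !inE => /orP [] /eqP -> /orP [] /eqP -> //; lia.
  exists u; rewrite ?inE ?eqxx //; apply/exists_inP.
  by exists v; rewrite ?inE ?eqxx ?orbT.
(* The loop 0, h, 2h, 3h, 0 winds once around the circle; the points 0, 1, 2 form an independent
   triple because h > 1. *)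
have [v0 [v0C [r0 d0]]] := point 0 L_gt0.
have [v1 [v1C [r1 d1]]] := point h L_gth.
have [v2 [v2C [r2 d2]]] := point (2 * h) L_gt2h.
have [v3 [v3C [r3 d3]]] := point (3 * h) lt_3h.
have [t1 [t1C [s1 e1]]] := point 1 L_gt1.
have [t2 [t2C [s2 e2]]] := point 2 L_gt2.
have [|||T TC indT T3|g gP] := @cohen_macaulay_component k _ G cmG C
  r 2 f (v0 |: [set t1; t2]) (@component_isolated) r_inj
  (@component_rank_lt w).
- by rewrite !subUset !sub1set v0C t1C t2C.
- have e01 : ~~ G v0 t1.
    by apply: (nonedge _ _ _ _ _ _ r0 s1) => //; apply: near_le => //; apply: ltnW.
  have e02 : ~~ G v0 t2.
    by apply: (nonedge _ _ _ _ _ _ r0 s2) => //; apply: near_le => //; apply: ltnW.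
  have e12 : ~~ G t1 t2.
    by apply: (nonedge _ _ _ _ _ _ s1 s2) => //; apply: near_le => //; apply: ltnW.
  apply/independentP => y z; rewrite !inE.
  by case/or3P => /eqP ->; case/or3P => /eqP ->; rewrite ?edge_irr // edge_sym.
- have neq y z : r y < r z -> y != z by apply: contraTneq => ->; rewrite ltnn.
  rewrite !cardsU1 cards1 !inE negb_or.
  by rewrite (neq v0 t1) ?(neq v0 t2) ?(neq t1 t2) // ?r0 ?s1 ?s2.
- have [u [v [z [TE uv vz]]]] := sorted_triple r_inj T3.
  have uz := ltn_trans uv vz.
  rewrite TE coboundary3 // !f2 //.
  have inT : [&& u \in T, v \in T & z \in T] by rewrite TE !inE !eqxx !orbT.
  have /and3P [uT vT zT] := inT.
  have ltz : r z < L by rewrite /r component_rank_in ?(subsetP TC) ?ltn_pmod.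
  have -> : (L./2 < r z - r u)%:R =
      ((L./2 < r z - r v)%:R + (L./2 < r v - r u)%:R)%R :> k.
    rewrite -GRing.natrD Lh; congr _%:R.
    by apply: crossing => //; apply: r_near TC indT _ _.
  by rewrite GRing.opprD GRing.addrA GRing.subrr GRing.sub0r GRing.addNr.
have gE u v : u \in C -> v \in C -> r u < r v -> ~~ G u v ->
    g [set v] = (g [set u] + (L./2 < r v - r u)%:R)%R.
  move=> uC vC uv nuv; rewrite -f2 // gP ?coboundary2 //.
  - by rewrite GRing.addrC GRing.subrK.
  - by rewrite subUset !sub1set uC.
  - exact: independent2.
  by rewrite cards2; case: eqP uv => // ->; rewrite ltnn.
have nedge u v p q : u \in C -> v \in C -> r u = p -> r v = q ->
    u %/ x = (w' * p) %% L -> v %/ x = (w' * q) %% L ->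
    p < q -> q < L -> cyclically_near h p q ->
    g [set v] = (g [set u] + (h + 2 < q - p)%:R)%R.
  move=> uC vC up vq up' vq' pq qL npq; rewrite (gE u v) ?up ?vq ?Lh //.
  by apply: (nonedge u v p q) => //; [apply: ltn_trans qL | rewrite ltn_eqF].
(* Following g along 0, h, 2h, 3h meets no crossing, whereas the direct edge from 0 to 3h has one;
   comparison gives 1 = 0. *)
have := nedge v0 v3 _ _ v0C v3C r0 r3 d0 d3 lt03 lt_3h near03.
rewrite (nedge v2 v3 _ _ v2C v3C r2 r3 d2 d3 lt23 lt_3h near23).
rewrite (nedge v1 v2 _ _ v1C v2C r1 r2 d1 d2 lt12 L_gt2h near12).
rewrite (nedge v0 v1 _ _ v0C v1C r0 r1 d0 d1 lt01 L_gth near01).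
rewrite gap0 gap1 gap2 gap3 !GRing.addr0 => /eqP.
by rewrite -[X in X == _]GRing.addr0 (inj_eq (GRing.addrI _)) eq_sym GRing.oner_eq0.
Qed.

End ComponentObstructions.

Lemma color_sum_irrelevant (k : fieldType) m (c : 'I_m -> nat) q :
  color_sum k c q \in @irrelevant_ideal k m.
Proof.
apply: (ideal_sum (generated_ideal_ideal _)) => v _.
by apply: generated_ideal_gen; exists v.
Qed.

(** * Vertex decompositions checked by computation on components *)

Section ComponentDecomposition.
Local Open Scope nat_scope.
Variables (k : fieldType) (L x a0 e n a : nat).
Hypotheses (x_gt0 : 0 < x) (a0_gt0 : 0 < a0) (lt_a0 : a0 < L./2).
Hypothesis evenL : ~~ odd L.
Hypotheses (aE : a = a0 * x) (nE : n = L./2 * x) (e_gt0 : 0 < e).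
Local Notation G := (circulant (2 * n) [:: a; n]).
Local Notation edgeE := (component_edgeE x_gt0 a0_gt0 lt_a0 evenL aE nE).
Local Notation adj := (component_edge L a0).

Definition remove_vertex p (B : bitseq) : bitseq :=
  mkseq (fun q => nth false B q && (q != p)) L.

(** The point [p] itself is kept, so this describes its star rather than its link. *)
Definition remove_neighbours p (B : bitseq) : bitseq :=
  mkseq (fun q => nth false B q && ~~ adj p q) L.

Definition transversal_bits (B : bitseq) : bool :=
  all (fun p => all (fun q => ~~ [&& nth false B p, nth false B q & adj p q])
    (iota 0 L)) (iota 0 L) &&
  all (fun col => count (fun p => nth false B p && (p %% e == col)) (iota 0 L) == 1)
    (iota 0 e).

Definition sheddable_bits (Bs : seq bitseq) (B : bitseq) p : bool :=
  [&& nth false B p, remove_vertex p B \in Bs, remove_neighbours p B \in Bs,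
    count id (remove_vertex p B) < count id B &
    count id (remove_neighbours p B) < count id B].

(** A certificate closed under shedding, with transversals as leaves; the decreasing counts in
    [sheddable_bits] give termination. *)
Definition decomposable_bits (Bs : seq bitseq) : bool :=
  all (fun B => transversal_bits B || has (sheddable_bits Bs B) (iota 0 L)) Bs.

(* [X q] lists the vertices of the component [q] that are kept. *)
Definition config_support (X : nat -> bitseq) : {set 'I_(2 * n)} :=
  [set i : 'I_(2 * n) | nth false (X (i %% x)) (i %/ x)].

Definition config_complex (X : nat -> bitseq) (S : {set 'I_(2 * n)}) : bool :=
  (S \subset config_support X) && independent G S.

(** Numbers the residue classes modulo [e] within each component, which are the cliques of the
    partition. *)
Definition component_color (i : 'I_(2 * n)) : nat := ((i %/ x) %% e) * x + i %% x.

Lemma component_color_eq (i : 'I_(2 * n)) q :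
  (component_color i == q) = ((i %/ x) %% e == q %/ x) && (i %% x == q %% x).
Proof.
rewrite /component_color; apply/eqP/andP => [<-|[/eqP -> /eqP ->]].
  by rewrite divnMDl // modnMDl modn_mod (divn_small (ltn_pmod _ _)) // addn0 !eqxx.
by rewrite -divn_eq.
Qed.

Lemma vertex_at p q : p < L -> q < x ->
  exists i : 'I_(2 * n), [/\ i %/ x = p & i %% x = q].
Proof.
move=> ltpL ltqx; have lt_i : p * x + q < 2 * n.
  rewrite (order_components evenL nE); apply: (@leq_trans (p.+1 * x)).
    by rewrite mulSn addnC ltn_add2r.
  by rewrite leq_mul2r ltpL orbT.
exists (Ordinal lt_i); rewrite /= divnMDl // divn_small // addn0.
by rewrite modnMDl modn_small.
Qed.

Lemma vertex_eq (i j : 'I_(2 * n)) :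
  (i == j) = (i %% x == j %% x) && (i %/ x == j %/ x).
Proof.
rewrite -val_eqE /=; apply/eqP/andP => [-> //|[/eqP qE /eqP pE]].
by rewrite (divn_eq i x) qE pE -divn_eq.
Qed.

Let quot_lt (i : 'I_(2 * n)) : i %/ x < L := component_index x_gt0 evenL nE i.

Lemma transversal_config X : (forall q, q < x -> transversal_bits (X q)) ->
  balanced_decomposable component_color (iota 0 (e * x)) (config_complex X).
Proof.
move=> trX; apply: (@BalancedSimplex _ _ _ _ (config_support X)) => [S|q].
  rewrite /config_complex /sr_simplex; case: (boolP (S \subset _)) => //= SX.
  apply/independentP => i j /(subsetP SX); rewrite inE => iX /(subsetP SX).
  rewrite inE => jX; rewrite edgeE; apply/negP => /andP [/eqP ij adj_ij].
  have /andP [/allP/(_ (i %/ x))] := trX _ (ltn_pmod i x_gt0).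
  rewrite mem_iota quot_lt => /(_ isT)/allP/(_ (j %/ x)).
  by rewrite mem_iota quot_lt => /(_ isT); rewrite iX ij jX adj_ij.
rewrite mem_iota /= => lt_q.
have /andP [_ /allP/(_ (q %/ x))] := trX _ (ltn_pmod q x_gt0).
rewrite mem_iota ltn_divLR // => /(_ lt_q); rewrite -size_filter.
set s := filter _ _; case sE : s => [|p [|]] // _.
have : p \in s by rewrite sE mem_head.
rewrite mem_filter mem_iota /= => /andP [/andP [pX pq] ltpL].
have [v [vp vq]] := vertex_at ltpL (ltn_pmod q x_gt0).
apply/eqP/cards1P; exists v; apply/setP => u.
rewrite !inE component_color_eq vertex_eq vp vq.
apply/and3P/andP => [[uX uc /eqP uq]|[/eqP uq /eqP up]]; last first.
  by rewrite up uq.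
split; first by rewrite uq.
have : u %/ x \in s by rewrite mem_filter mem_iota quot_lt uc -uq uX.
by rewrite sE inE.
Qed.

Definition config_update (X : nat -> bitseq) q B : nat -> bitseq :=
  fun q' => if q' == q then B else X q'.

Lemma config_star X (v : 'I_(2 * n)) p q :
  v %/ x = p -> v %% x = q -> nth false (X q) p ->
  sr_star v (config_complex X) =1
    config_complex (config_update X q (remove_neighbours p (X q))).
Proof.
move=> vp vq vX S; rewrite /sr_star /config_complex /config_update.
apply/andP/andP => -[SX indS].
  split; last by apply: simplicial_independent indS; apply: subsetUr.
  apply/subsetP => i iS; have := subsetP SX i (setU1r _ iS); rewrite !inE => iX.
  case: eqP => [iq|//]; rewrite nth_mkseq // -iq iX /=.
  have := independentP _ _ indS v i (setU11 _ _) (setU1r _ iS).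
  by rewrite edgeE vq iq eqxx vp.
have sub i : i \in S -> i \in config_support X.
  move=> /(subsetP SX); rewrite !inE; case: eqP => // ->.
  by rewrite nth_mkseq // => /andP [].
have nv i : i \in S -> ~~ G v i.
  move=> /(subsetP SX); rewrite edgeE vq vp inE eq_sym; case: eqP => //= _.
  by rewrite nth_mkseq // => /andP [].
split.
  by apply/subsetP => i /setU1P [->|/sub //]; rewrite inE vq vp.
apply/independentP => i j /setU1P [->|iS] /setU1P [->|jS].
- by rewrite edge_irr.
- exact: nv.
- by rewrite edge_sym; apply: nv.
- exact: (independentP _ _ indS).
Qed.

Lemma config_deletion X (v : 'I_(2 * n)) p q : v %/ x = p -> v %% x = q ->
  sr_deletion v (config_complex X) =1
    config_complex (config_update X q (remove_vertex p (X q))).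
Proof.
move=> vp vq S; rewrite /sr_deletion /config_complex /config_update andbAC.
congr andb; apply/andP/subsetP => [[/subsetP SX vS] i iS|SX].
  have := SX i iS; rewrite !inE; case: eqP => // iq iX.
  rewrite nth_mkseq // -iq iX -vp; apply: contra vS => /eqP ip.
  suff -> : v = i by [].
  by apply/eqP; rewrite vertex_eq vq iq ip !eqxx.
split; last first.
  apply/negP => /SX; rewrite inE vq eqxx nth_mkseq ?vp ?eqxx ?andbF //.
  by rewrite -vp.
apply/subsetP => i /SX; rewrite !inE; case: eqP => // ->.
by rewrite nth_mkseq // => /andP [].
Qed.

(** Induction on the total number of kept vertices: a vertex is shed in some component that is not
    yet transversal, and when none is left the complex is a simplex. *)
Lemma config_decomposable Bs X : decomposable_bits Bs ->
  (forall q, q < x -> X q \in Bs) ->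
  balanced_decomposable component_color (iota 0 (e * x)) (config_complex X).
Proof.
move=> /allP decBs; pose weight X := \sum_(q < x) count id (X q).
have [N] := ubnP (weight X); elim: N X => // N IH X ltN XBs.
have [trX|] := boolP [forall q : 'I_x, transversal_bits (X q)].
  by apply: transversal_config => q ltqx; apply: (forallP trX (Ordinal ltqx)).
case/forallPn => q ntr; have := decBs _ (XBs q (ltn_ord q)); rewrite (negPf ntr).
case/hasP => p; rewrite mem_iota => /= ltpL.
case/and5P => pX vBs nBs ltv ltn.
have [v [vp vq]] := vertex_at ltpL (ltn_ord q).
have update B : B \in Bs -> count id B < count id (X q) ->
    balanced_decomposable component_color (iota 0 (e * x))
      (config_complex (config_update X q B)).
  move=> BBs ltB; apply: IH => [|q' ltq'].
    rewrite ltnS in ltN; apply: leq_trans ltN; rewrite /weight.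
    rewrite (bigD1 q) //= [X in _ < X](bigD1 q) //= /config_update eqxx.
    rewrite -addSn leq_add // leq_sum // => q' nq'; rewrite ifF //.
    exact: negbTE.
  by rewrite /config_update; case: eqP => // _; apply: XBs.
apply: (@BalancedShed _ _ _ _ v).
  by rewrite (funext (config_star vp vq pX)); apply: update.
by rewrite (funext (config_deletion X vp vq)); apply: update.
Qed.

(** The colour sums form a regular sequence. Colour classes are cliques, so an independent set has
    at most one vertex of each colour and cannot outnumber the sequence. *)
Lemma decomposable_cohen_macaulay Bs : decomposable_bits Bs ->
  nseq L true \in Bs ->
  all (fun p => all (fun q => (p %% e == q %% e) ==> (p == q) || adj p q)
    (iota 0 L)) (iota 0 L) ->
  cohen_macaulay_graph k G.
Proof.
move=> decBs BsL /allP cliques; set c := component_color.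
have simG := @simplicial_independent _ G.
pose fs := [seq color_sum k c q | q <- iota 0 (e * x)].
have size_fs : size fs = e * x by rewrite size_map size_iota.
apply: (@regular_cohen_macaulay _ _ _ (independent G) simG
  (@edge_ideal_sr k _ G) fs) => //.
- by move=> _ /mapP [q _ ->]; apply: color_sum_irrelevant.
- apply: balanced_regular => //; first exact: iota_uniq.
  have -> : independent G = config_complex (fun=> nseq L true).
    apply/funext => S; rewrite /config_complex; case: (independent G S).
      rewrite andbT; apply/esym/subsetP => i _.
      by rewrite inE nth_nseq quot_lt.
    by rewrite andbF.
  by apply: (config_decomposable decBs).
- move=> W /independentP indW; rewrite size_fs.
  have c_lt i : c i < e * x.
    rewrite /c /component_color; apply: (@leq_trans (((i %/ x) %% e).+1 * x)).
      by rewrite [X in _ < X]mulSn addnC ltn_add2r ltn_pmod.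
    by rewrite leq_mul2r ltn_pmod ?orbT.
  pose c' i : 'I_(e * x) := Ordinal (c_lt i).
  rewrite -(card_in_imset (f := c')).
    by apply: leq_trans (max_card _) _; rewrite card_ord.
  move=> i j iW jW /(congr1 val) /= /eqP.
  rewrite component_color_eq.
  have -> : c j %/ x = (j %/ x) %% e.
    by rewrite /c /component_color divnMDl // (divn_small (ltn_pmod _ _)) // addn0.
  have -> : c j %% x = j %% x by rewrite /c /component_color modnMDl modn_mod.
  case/andP => pE qE; apply/eqP; rewrite vertex_eq qE /=.
  have /allP/(_ (j %/ x)) := cliques (i %/ x) ltac:(by rewrite mem_iota quot_lt).
  rewrite mem_iota quot_lt pE => /(_ isT) /= /orP [//|adj_ij].
  by have := indW i j iW jW; rewrite edgeE qE adj_ij.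
by rewrite size_fs muln_gt0 e_gt0.
Qed.

End ComponentDecomposition.

(** * Arithmetic of the cases s = 3 and s = 4 *)

Section Classification.
Local Open Scope nat_scope.

Lemma quotient_gcdn3 n a x : 0 < x -> a = 2 * x -> n = 3 * x ->
  (2 * n) %/ gcdn a (2 * n) = 3.
Proof.
move=> x_gt0 -> ->; rewrite mulnCA (gcdn_idPl (dvdn_mull _ _)) //.
by rewrite mulnK ?muln_gt0.
Qed.

Lemma quotient_gcdn4 n a x : 0 < x -> a = x -> n = 2 * x ->
  (2 * n) %/ gcdn a (2 * n) = 4.
Proof.
move=> x_gt0 -> ->; rewrite mulnA (gcdn_idPl (dvdn_mull _ _)) //.
by rewrite mulnK.
Qed.

(** With a = q g and 2n = s g, the bound a < n reads 2q < s, so s = 3 or 4 forces q = 1; for s = 3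
    the gcd g is even. *)
Lemma quotient_gcdn_inv n a : 0 < a -> a < n ->
  (2 * n) %/ gcdn a (2 * n) = 3 \/ (2 * n) %/ gcdn a (2 * n) = 4 ->
  exists2 x, 0 < x & (a = 2 * x /\ n = 3 * x) \/ (a = x /\ n = 2 * x).
Proof.
move=> a_gt0 lt_an; set g := gcdn _ _ => H.
have g_gt0 : 0 < g by rewrite gcdn_gt0 a_gt0.
have /dvdnP [q aE] : g %| a := dvdn_gcdl _ _.
have /dvdnP [s nE] : g %| 2 * n := dvdn_gcdr _ _.
move: H; rewrite nE mulnK // => -[sE|sE].
  have q1 : q = 1 by nia.
  by exists (g./2); lia.
have q1 : q = 1 by nia.
by exists g => //; right; lia.
Qed.

End Classification.

Theorem theorem5p5 (k : fieldType) (n a : nat) (a_ge1 : (1 <= a)%N)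
    (a_lt_n : (a < n)%N) :
  cohen_macaulay_graph k (circulant (2 * n)%N [:: a; n]) <->
  ((2 * n) %/ gcdn a (2 * n) = 3)%N \/ ((2 * n) %/ gcdn a (2 * n) = 4)%N.
Proof.
split=> [cmG|].
  have claw := @claw_not_cohen_macaulay k n a a_ge1 a_lt_n.
  have [e1|ne1] := eqVneq (2 * a)%N n.
    by right; apply: (quotient_gcdn4 a_ge1).
  have [e2|ne2] := eqVneq (3 * a)%N (2 * n)%N.
    by left; apply: (@quotient_gcdn3 n a a./2); lia.
  exfalso.
  (* The remaining equalities are s = 8 (4a = n or 3n), s = 5 (5a = 2n or 4n) and s = 6 (3a = n).
     For s = 8 and 5 the multiplier [w] satisfies w a0 = L/2 - 1 modulo L, so that adjacency becomes
     distance at least L/2 - 1 = h + 1. *)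
  have [e3|ne3] := eqVneq (4 * a)%N n.
    apply: (@circle_not_cohen_macaulay k 8 a 1 n a _ _ _ _ _ _ 3 3 2) cmG => //; lia.
  have [e4|ne4] := eqVneq (4 * a)%N (3 * n)%N.
    have [x aE nE] : exists2 x, a = (3 * x)%N & n = (4 * x)%N
      by exists (n - a)%N; lia.
    apply: (@circle_not_cohen_macaulay k 8 x 3 n a _ _ _ _ _ _ 1 1 2) cmG => //; lia.
  have [e5|ne5] := eqVneq (5 * a)%N (2 * n)%N.
    have [x aE nE] : exists2 x, a = (2 * x)%N & n = (5 * x)%N
      by exists (n - 2 * a)%N; lia.
    apply: (@circle_not_cohen_macaulay k 10 x 2 n a _ _ _ _ _ _ 7 3 3) cmG => //; lia.
  have [e6|ne6] := eqVneq (5 * a)%N (4 * n)%N.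
    have [x aE nE] : exists2 x, a = (4 * x)%N & n = (5 * x)%N
      by exists (n - a)%N; lia.
    apply: (@circle_not_cohen_macaulay k 10 x 4 n a _ _ _ _ _ _ 1 1 3) cmG => //; lia.
  have [e7|ne7] := eqVneq (3 * a)%N n.
    apply: (@bipartite_not_cohen_macaulay k 6 a 1 n a) cmG => //; lia.
  by apply: claw cmG; apply/eqP.
case/(quotient_gcdn_inv a_ge1 a_lt_n) => x x_gt0 [] [aE nE].
  (* In a prism the two triangles are the parity classes. The list holds the subsets reached by
     always shedding the first kept point that has a kept neighbour. *)
  apply: (@decomposable_cohen_macaulay k 6 x 2 2 n a _ _ _ _ _ _ _
    [:: [:: true; true; true; true; true; true];
        [:: false; true; true; true; true; true];
        [:: false; false; true; true; true; true];
        [:: false; false; false; true; true; true];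
        [:: false; false; false; false; true; true];
        [:: true; true; false; false; false; true];
        [:: true; true; false; false; false; false];
        [:: true; false; false; false; false; true];
        [:: false; true; true; false; false; false];
        [:: false; false; true; true; false; false];
        [:: false; false; false; true; true; false]]) => //.
(* Each copy of K_4 is a single clique, and shedding runs through its points in order. *)
apply: (@decomposable_cohen_macaulay k 4 x 1 1 n a _ _ _ _ _ _ _
  [:: [:: true; true; true; true]; [:: false; true; true; true];
      [:: false; false; true; true]; [:: false; false; false; true];
      [:: true; false; false; false]; [:: false; true; false; false];
      [:: false; false; true; false]]) => //.
by rewrite mul1n.
Qed.
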